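(* Consider $\Psi^*:=\min_{x\in X}\{\Psi(x)=f(x)+h(x)\}$ (that is, $\mu=0$), and suppose $x_0\in X$ and $\Omega_X\ge0$ satisfy $\max_{x\in X}P_\omega(x_0,x)\le\Omega_X^2$. For $\epsilon>0$, let $$\delta=\frac{\epsilon}{2\Omega_X^2}$$ and apply the RPDG method, with the parameter settings given in the context, to the perturbation problem $$\Psi_\delta^*:=\min_{x\in X}\{\Psi_\delta(x):=f(x)+h(x)+\delta P_\omega(x_0,x)\}.$$ Then one can find a solution $\bar x\in X$ such that $\mathbb{E}[\Psi(\bar x)-\Psi^*]\le\epsilon$ in at most $$\mathcal{O}\Big\{\Big(m+\sqrt{\frac{mL\Omega_X^2}{\epsilon}}\Big)\log\frac{mL_f\Omega_X}{\epsilon}\Big\}$$ iterations. Moreover, one can find a solution $\bar x\in X$ such that $\mathrm{Prob}\{\Psi(\bar x)-\Psi^*>\epsilon\}\le\lambda$, for any $\lambda\in(0,1)$, in at most $$\mathcal{O}\Big\{\Big(m+\sqrt{\frac{mL\Omega_X^2}{\epsilon}}\Big)\log\frac{mL_f\Omega_X}{\lambda\epsilon}\Big\}$$ iterations.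
   Context: Problem data: $X\subseteq\mathbb{R}^n$ closed convex (and bounded, so that $\Omega_X$ exists); $\|\cdot\|$ an arbitrary norm with conjugate norm $\|\cdot\|_*$; $f=\sum_{i=1}^mf_i$ with $f_i:\mathbb{R}^n\to\mathbb{R}$ convex, differentiable, $\|\nabla f_i(x_1)-\nabla f_i(x_2)\|_*\le L_i\|x_1-x_2\|$; $L=\sum_iL_i$; $L_f\ge0$ a constant with $\|\nabla f(x_1)-\nabla f(x_2)\|_*\le L_f\|x_1-x_2\|\le L\|x_1-x_2\|$; $h:X\to\mathbb{R}$ convex; $\omega:X\to\mathbb{R}$ strongly convex with modulus $1$ w.r.t. $\|\cdot\|$; $P_\omega(x_0,x)=\omega(x)-[\omega(x_0)+\langle\omega'(x_0),x-x_0\rangle]$, $\omega'(x_0)\in\partial\omega(x_0)$. The perturbation problem is (up to a constant) of the form $\min_{x\in X}\{f(x)+\hat h(x)+\hat\mu\,\omega(x)\}$ with $\hat\mu=\delta$ and $\hat h(x)=h(x)-\delta\langle\omega'(x_0),x\rangle$. RPDG method for it: let $x^0=x^{-1}=x_0$, $\underline x_i^0=x^0$, $y_i^0=\nabla f_i(x^0)$. For $t=1,\dots,k$: draw $i_t$ independently with $\mathrm{Prob}\{i_t=i\}=p_i$; $\tilde x^t=\alpha(x^{t-1}-x^{t-2})+x^{t-1}$; for $i=i_t$: $\underline x_i^t=(\tilde x^t+\tau\underline x_i^{t-1})/(1+\tau)$, $y_i^t=\nabla f_i(\underline x_i^t)$, $\tilde y_i^t=p_i^{-1}(y_i^t-y_i^{t-1})+y_i^{t-1}$;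 for $i\neq i_t$: $\underline x_i^t=\underline x_i^{t-1}$, $y_i^t=\tilde y_i^t=y_i^{t-1}$; then $x^t=\arg\min_{x\in X}\{\langle\sum_i\tilde y_i^t,x\rangle+\hat h(x)+\hat\mu\,\omega(x)+\eta P_\omega(x^{t-1},x)\}$, where the subgradient $\omega'(x^t)$ used in $P_\omega(x^t,\cdot)$ is one satisfying the first-order optimality condition of this subproblem. Output: $\bar x^k=(\sum_{t=1}^k\theta_t)^{-1}\sum_{t=1}^k\theta_tx^t$, $\theta_t=\alpha^{-t}$. Parameter settings: $p_i=\frac1{2m}+\frac{L_i}{2L}$, $C=8L/\hat\mu$, $\tau=\frac{\sqrt{(m-1)^2+4mC}-(m-1)}{2m}$, $\eta=\frac{\hat\mu\sqrt{(m-1)^2+4mC}+\hat\mu(m-1)}2$, $\alpha=1-\frac1{(m+1)+\sqrt{(m-1)^2+4mC}}$. $\mathcal{O}$ hides absolute constants.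
   Formalization: The claim is stated for 0 < ε ≤ m L_f min(1, Ω_X/2) instead of all ε > 0: for large ε the logarithm is negative or too small and the bound fails; this range forces L_f, Ω_X > 0 and mL_fΩ_X/ε ≥ max(2, Ω_X). *)

(* Defs.v *)
(* Vectors of R^n are rows 'rV[R]_n; their topology is the
   canonical one, while the norm of the problem is an arbitrary function N
   satisfying the norm axioms. Functions on X are total functions whose values
   outside X are never used. *)
From HB Require Import structures.
From mathcomp Require Export all_boot all_order all_algebra.
From mathcomp Require Export all_classical all_reals all_analysis.
Export Order.TTheory GRing.Theory Num.Theory.
Export numFieldNormedType.Exports.

Set Implicit Arguments.
Unset Strict Implicit.
Unset Printing Implicit Defensive.

Global Open Scope classical_set_scope.
Global Open Scope ring_scope.

Section convex_optimization.
Context {R : realType} {n : nat}.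
Local Notation V := 'rV[R]_n.

Definition dot (u v : V) : R := \sum_(j < n) u 0 j * v 0 j.

Record is_norm (N : V -> R) : Prop := IsNorm {
  norm_triangle : forall x y, N (x + y) <= N x + N y;
  norm_scale : forall (a : R) x, N (a *: x) = `|a| * N x;
  norm_definite : forall x, N x = 0 -> x = 0 }.

Definition dual_norm (N : V -> R) (y : V) : R :=
  sup [set dot y x | x in [set x | N x <= 1]].

Definition gradient (F : V -> R) (x : V) : V :=
  \row_j 'D_(delta_mx 0 j) F x.

(* g is a subgradient at x of F extended by +oo outside X *)
Definition subdifferential (X : set V) (F : V -> R) (x : V) : set V :=
  [set g | forall u, X u -> F x + dot g (u - x) <= F u].

Definition strongly_convex (N : V -> R) (sigma : R) (X : set V) (F : V -> R) :=
  forall (x y : V) (t : R), X x -> X y -> 0 <= t <= 1 ->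
    F (t *: x + (1 - t) *: y) + sigma / 2 * t * (1 - t) * N (x - y) ^+ 2
    <= t * F x + (1 - t) * F y.

Definition is_min (X : set V) (F : V -> R) (v : R) : Prop :=
  (exists2 x, X x & F x = v) /\ (forall x, X x -> v <= F x).

Definition is_argmin (X : set V) (F : V -> R) (x : V) : Prop :=
  X x /\ (forall u, X u -> F x <= F u).

(* P_omega(x0, x), for the choice g of the subgradient omega'(x0) *)
Definition prox (omega : V -> R) (g x0 x : V) : R :=
  omega x - (omega x0 + dot g (x - x0)).

End convex_optimization.

Section rpdg_parameters.
Context {R : realType} {m : nat}.
Variables (Ls : 'I_m -> R) (muhat : R).

Definition rpdg_L : R := \sum_(i < m) Ls i.
Definition rpdg_p (i : 'I_m) : R := 1 / (2 * m%:R) + Ls i / (2 * rpdg_L).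
Definition rpdg_C : R := 8 * rpdg_L / muhat.
Definition rpdg_root : R :=
  Num.sqrt ((m%:R - 1) ^+ 2 + 4 * m%:R * rpdg_C).
Definition rpdg_tau : R := (rpdg_root - (m%:R - 1)) / (2 * m%:R).
Definition rpdg_eta : R := (muhat * rpdg_root + muhat * (m%:R - 1)) / 2.
Definition rpdg_alpha : R := 1 - 1 / ((m%:R + 1) + rpdg_root).

End rpdg_parameters.

Section rpdg.
Context {R : realType} {n m : nat}.
Local Notation V := 'rV[R]_n.

Record trajectory := Trajectory {
  rx : nat -> V;                (* x^t *)
  rxu : nat -> 'I_m -> V;       (* \underline x_i^t *)
  ry : nat -> 'I_m -> V;        (* y_i^t *)
  ryt : nat -> 'I_m -> V;       (* \tilde y_i^t, for t >= 1 *)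
  rg : nat -> V }.              (* the subgradient omega'(x^t) *)

(* One run of k iterations on min_X { \sum_i f_i + hhat + muhat * omega } along
   the draws i_1, ..., i_k. Iteration t.+1 reads x^t and x^(t-1): for t = 0 the
   truncated predecessor gives x 0.-1 = x 0, which is the convention
   x^(-1) = x^0. *)
Record rpdg_trajectory (X : set V) (f : 'I_m -> V -> R) (hhat omega : V -> R)
    (muhat : R) (p : 'I_m -> R) (tau eta alpha : R) (x0 g0 : V) (k : nat)
    (i_ : nat -> 'I_m) (z : trajectory) : Prop := RpdgTrajectory {
  rpdg_x0 : rx z 0 = x0;
  rpdg_g0 : rg z 0 = g0;
  rpdg_xu0 : forall i, rxu z 0 i = x0;
  rpdg_y0 : forall i, ry z 0 i = gradient (f i) x0;
  rpdg_xu : forall t i, (t < k)%N ->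
    rxu z t.+1 i =
      if i == i_ t.+1 then
        let xtilde := alpha *: (rx z t - rx z t.-1) + rx z t in
        (1 + tau)^-1 *: (xtilde + tau *: rxu z t i)
      else rxu z t i;
  rpdg_y : forall t i, (t < k)%N ->
    ry z t.+1 i =
      if i == i_ t.+1 then gradient (f i) (rxu z t.+1 i) else ry z t i;
  rpdg_yt : forall t i, (t < k)%N ->
    ryt z t.+1 i =
      if i == i_ t.+1 then (p i)^-1 *: (ry z t.+1 i - ry z t i) + ry z t i
      else ry z t i;
  rpdg_x : forall t, (t < k)%N ->
    is_argmin X (fun u => dot (\sum_i ryt z t.+1 i) u + hhat u
                 + muhat * omega u + eta * prox omega (rg z t) (rx z t) u)
      (rx z t.+1);
  rpdg_g : forall t, (t < k)%N ->
    subdifferential X omega (rx z t.+1) (rg z t.+1);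
  (* first-order optimality condition of the subproblem; the gradient of
     u |-> prox omega g_t x^t u at x^(t+1) is g_(t+1) - g_t *)
  rpdg_optimality : forall t, (t < k)%N ->
    exists2 hg, subdifferential X hhat (rx z t.+1) hg &
      forall u, X u ->
        0 <= dot (\sum_i ryt z t.+1 i + hg + muhat *: rg z t.+1
                  + eta *: (rg z t.+1 - rg z t)) (u - rx z t.+1) }.

(* \bar x^k, with weights theta_t = alpha^(-t) *)
Definition rpdg_output (alpha : R) (k : nat) (z : trajectory) : V :=
  (\sum_(1 <= t < k.+1) alpha ^- t)^-1
    *: \sum_(1 <= t < k.+1) alpha ^- t *: rx z t.

End rpdg.
Arguments trajectory : clear implicits.

Section random_rpdg.
Context {R : realType} {n m : nat} {d : measure_display}
  {T : measurableType d}.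
Local Notation V := 'rV[R]_n.

Record iid_draws (P : probability T R) (p : 'I_m -> R) (k : nat)
    (i_ : nat -> T -> 'I_m) : Prop := IidDraws {
  draws_measurable : forall t j, (0 < t <= k)%N ->
    measurable (i_ t @^-1` [set j]);
  draws_law : forall t j, (0 < t <= k)%N ->
    P (i_ t @^-1` [set j]) = (p j)%:E;
  draws_independent : forall (J : seq nat) (B : nat -> set 'I_m),
    uniq J -> (forall t, t \in J -> (0 < t <= k)%N) ->
    P (\bigcap_(t in [set` J]) (i_ t @^-1` B t))
    = (\prod_(t <- J) P (i_ t @^-1` B t))%E }.

(* A random run. The subgradient omega'(x^t) is the only quantity the method
   leaves to be chosen (x^t is the minimizer of a strongly convex function); it
   is chosen during iteration t, hence without knowledge of i_(t+1), ..., i_k. *)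
Record rpdg_run (P : probability T R) (X : set V) (f : 'I_m -> V -> R)
    (hhat omega : V -> R) (muhat : R) (p : 'I_m -> R) (tau eta alpha : R)
    (x0 g0 : V) (k : nat) (i_ : nat -> T -> 'I_m)
    (z : T -> trajectory R n m) : Prop := RpdgRun {
  run_draws : iid_draws P p k i_;
  run_trajectory : forall s,
    rpdg_trajectory X f hhat omega muhat p tau eta alpha x0 g0 k
      (fun t => i_ t s) (z s);
  run_nonanticipative : forall t s s', (t <= k)%N ->
    (forall r, (0 < r <= t)%N -> i_ r s = i_ r s') ->
    rg (z s) t = rg (z s') t }.

End random_rpdg.

(* Main.v *)
Require Import Defs.
From mathcomp Require Import ring lra measurable_realfun.

Set Implicit Arguments.
Unset Strict Implicit.
Unset Printing Implicit Defensive.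

(* Write B_i(u, v) for the Bregman distance of f_i, so that the dual divergence
   between the gradients of f_i at u and v is B_i(u, v), and let x* minimize the
   perturbed objective F + hhat + delta omega. With
     G(x) = <grad F(x* ), x - x*> + (hhat + delta omega)(x) - (hhat + delta omega)(x* ),
   the potential
     Phi_t = (eta + delta) P(x^t, x* ) + (1 + tau) sum_i B_i(u_i^t, x* ) / p_i
             + <sum_i y_i^t - grad F(x* ), x^t - x^(t-1)> + eta/4 |x^t - x^(t-1)|^2
   satisfies E[G(x^t) + Phi_t] <= alpha E[Phi_(t-1)]: the cross terms are absorbed
   because eta tau = 8 L and p_i >= L_i / (2 L). Hence
   E[G(xbar)] <= (1 - alpha) Phi_0 / (alpha^(-k) - 1), and the choice of the
   parameters gives (1 - alpha) Phi_0 <= (delta/2 + L_f) Omega^2 with no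
   dependence on m and L. The perturbed gap is at most (1 + L_f/delta) G(xbar),
   since strong convexity makes G dominate the quadratic error of linearizing F.
   Expectations are finite sums over the words of draws, because a run is a
   function of its word. *)

(** * Norms and smooth functions *)

Section dot_theory.
Context {R : realType} {n : nat}.
Implicit Types u v w : 'rV[R]_n.

Lemma dotC u v : dot u v = dot v u.
Proof. by apply: eq_bigr => j _; rewrite mulrC. Qed.

Lemma dotDl u v w : dot (u + v) w = dot u w + dot v w.
Proof. by rewrite -big_split; apply: eq_bigr => j _; rewrite mxE mulrDl. Qed.

Lemma dotZl a u v : dot (a *: u) v = a * dot u v.
Proof. by rewrite /dot mulr_sumr; apply: eq_bigr => j _; rewrite mxE mulrA. Qed.

Lemma dotNl u v : dot (- u) v = - dot u v.
Proof. by rewrite -scaleN1r dotZl mulN1r. Qed.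

Lemma dotBl u v w : dot (u - v) w = dot u w - dot v w.
Proof. by rewrite dotDl dotNl. Qed.

Lemma dot0l v : dot 0 v = 0.
Proof. by rewrite -(scale0r 0) dotZl mul0r. Qed.

Lemma dotDr u v w : dot u (v + w) = dot u v + dot u w.
Proof. by rewrite dotC dotDl !(dotC _ u). Qed.

Lemma dotZr a u v : dot u (a *: v) = a * dot u v.
Proof. by rewrite dotC dotZl dotC. Qed.

Lemma dotNr u v : dot u (- v) = - dot u v.
Proof. by rewrite dotC dotNl dotC. Qed.

Lemma dotBr u v w : dot u (v - w) = dot u v - dot u w.
Proof. by rewrite dotDr dotNr. Qed.

Lemma dot0r v : dot v 0 = 0.
Proof. by rewrite dotC dot0l. Qed.

Lemma dot_suml (I : finType) (F : I -> 'rV[R]_n) v :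
  dot (\sum_i F i) v = \sum_i dot (F i) v.
Proof.
apply: (big_morph (fun u => dot u v)) => [u w|]; first exact: dotDl.
exact: dot0l.
Qed.

End dot_theory.

Definition dotE := (@dotDl, @dotBl, @dotNl, @dotZl, @dotDr, @dotBr, @dotNr, @dotZr).

Section norm_theory.
Context {R : realType} {n : nat} (N : 'rV[R]_n -> R) (normN : is_norm N).
Implicit Types x y v : 'rV[R]_n.

Lemma norm_zero : N 0 = 0.
Proof. by rewrite -(scale0r 0) (norm_scale normN) normr0 mul0r. Qed.

Lemma norm_opp x : N (- x) = N x.
Proof. by rewrite -scaleN1r (norm_scale normN) normrN1 mul1r. Qed.

Lemma norm_nonneg x : 0 <= N x.
Proof.
have := norm_triangle normN x (- x); rewrite subrr norm_zero norm_opp; lra.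
Qed.

Lemma norm_dist x y : `|N x - N y| <= N (x - y).
Proof.
have h1 := norm_triangle normN (x - y) y.
have h2 := norm_triangle normN (y - x) x.
rewrite !subrK in h1 h2; rewrite -opprB norm_opp in h2.
by rewrite ler_norml; apply/andP; split; lra.
Qed.

Lemma coord_le_mx_norm x j : `|x 0 j| <= `|x|.
Proof.
rewrite [leRHS]/Num.Def.normr /= mx_normrE; apply/bigmax_geP; right => /=.
by exists (0, j).
Qed.

(** Expand x in the canonical basis and apply the triangle inequality; with the next bound this is
    the equivalence of norms in finite dimension. *)
Lemma norm_le_mx_norm : exists2 K : R, 0 < K & forall x, N x <= K * `|x|.
Proof.
(* The summand 1 only makes the constant positive, in particular for n = 0. *)
exists (1 + \sum_j N (delta_mx 0 j)).
  by rewrite ltr_pwDl ?sumr_ge0// => j _; exact: norm_nonneg.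
move=> x; rewrite {1}(row_sum_delta x) mulrDl mul1r mulr_suml.
have /le_trans-> // : N (\sum_j x 0 j *: delta_mx 0 j) <=
  \sum_j N (x 0 j *: delta_mx 0 j).
  apply: (big_ind2 (fun u a => N u <= a)) => [|u a v b ua vb|//].
    by rewrite norm_zero.
  by apply: le_trans (norm_triangle normN _ _) _; exact: lerD.
apply: le_trans (_ : _ <= \sum_j N (delta_mx 0 j) * `|x|) _.
  apply: ler_sum => j _; rewrite (norm_scale normN) mulrC ler_wpM2l ?norm_nonneg//.
  exact: coord_le_mx_norm.
by rewrite lerDr.
Qed.

Lemma is_norm_continuous : continuous N.
Proof.
have [K K0 hK] := norm_le_mx_norm.
move=> x; apply/(@cvgrPdist_le _ _ _ (nbhs x)) => e e0.
near=> y.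
apply: le_trans (norm_dist _ _) _; apply: le_trans (hK _) _.
rewrite mulrC -ler_pdivlMr//; near: y.
by apply: (@cvgr_dist_le _ _ _ (nbhs x)); rewrite ?divr_gt0//; exact: cvg_id.
Unshelve. all: by end_near. Qed.

(** [N] attains a positive minimum on the compact unit sphere of the sup norm; its inverse is the
    constant. *)
Lemma mx_norm_le_norm : exists2 K : R, 0 < K & forall x, `|x| <= K * N x.
Proof.
pose S := [set x : 'rV[R]_n | `|x| = 1].
(* An empty sphere means that every vector is zero, and any constant works. *)
have [S0|/set0P S_neq0] := eqVneq S set0.
  exists 1 => // x; have [->|x0] := eqVneq x 0; first by rewrite normr0 mulr_ge0 ?norm_nonneg.
  have : S (`|x|^-1 *: x) by rewrite /S/= normrZ normfV normr_id mulVf ?normr_eq0.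
  by rewrite S0.
have Scpt : compact S.
  apply: bounded_closed_compact.
    by exists 1; split => // M M1 x /= ->; exact: ltW.
  rewrite (_ : S = (@Num.Def.normr _ _) @^-1` [set 1])//.
  apply: closed_comp => [x _|]; first exact: norm_continuous.
  exact: closed_eq.
have [c] := compact_EVT_min S_neq0 Scpt
  (continuous_subspaceT is_norm_continuous).
rewrite inE => Sc cmin; have Nc0 : 0 < N c.
  rewrite lt_neqAle norm_nonneg andbT eq_sym; apply/eqP => /(norm_definite normN) c0.
  by move: Sc; rewrite /S/= c0 normr0 => /eqP; rewrite eq_sym oner_eq0.
exists (N c)^-1; rewrite ?invr_gt0// => x.
have [->|x0] := eqVneq x 0; first by rewrite normr0 mulr_ge0 ?invr_ge0 ?norm_nonneg.
have /cmin : `|x|^-1 *: x \in S.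
  by rewrite inE /S/= normrZ normfV normr_id mulVf ?normr_eq0.
rewrite (norm_scale normN) normfV normr_id mulrC ler_pdivlMr ?normr_gt0// => h.
by rewrite mulrC ler_pdivlMr// mulrC.
Qed.

(** The dual norm is a real [sup], so it is informative only once its set is known to be bounded;
    [mx_norm_le_norm] gives the bound. The rest is scaling v to norm 1. *)
Lemma dot_le_dual_norm y v : dot y v <= dual_norm N y * N v.
Proof.
have [K K0 hK] := mx_norm_le_norm.
have ub : has_ubound [set dot y x | x in [set x | N x <= 1]].
  exists (\sum_j `|y 0 j| * K) => _ [x /= Nx1 <-].
  apply: ler_sum => j _; apply: le_trans (ler_norm _) _.
  rewrite normrM ler_wpM2l//; apply: le_trans (coord_le_mx_norm _ _) _.
  by apply: le_trans (hK x) _; rewrite -[leRHS]mulr1 ler_wpM2l// ltW.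
have [v0|v0] := eqVneq v 0; first by rewrite v0 dot0r norm_zero mulr0.
have Nv0 : 0 < N v.
  by rewrite lt_neqAle norm_nonneg andbT eq_sym; apply: contra_neq v0 => /(norm_definite normN).
rewrite -ler_pdivrMr// mulrC -dotZr; apply: ub_le_sup => //.
exists ((N v)^-1 *: v) => //=.
by rewrite (norm_scale normN) ger0_norm ?invr_ge0 ?norm_nonneg// mulVf ?gt_eqF.
Qed.

End norm_theory.

Section calculus.
Context {R : realType} {n : nat}.
Local Notation V := 'rV[R]_n.

Lemma derive_dot_gradient (F : V -> R) (x v : V) :
  differentiable F x -> 'D_v F x = dot (gradient F x) v.
Proof.
move=> dF; rewrite deriveE// {1}(row_sum_delta v) linear_sum.
apply: eq_bigr => j _; rewrite linearZ/= -deriveE// mxE.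
by rewrite mulrC.
Qed.

Lemma gradient_sum (m : nat) (f : 'I_m -> V -> R) (x : V) :
  (forall i, differentiable (f i) x) ->
  gradient (fun y => \sum_i f i y) x = \sum_i gradient (f i) x.
Proof.
move=> df; apply/rowP => j; rewrite summxE mxE.
rewrite (_ : (fun y => _) = \sum_i f i); last by apply/funext => y; rewrite fct_sumE.
by rewrite derive_sum => [|i]; [apply: eq_bigr => i _; rewrite mxE|exact: diff_derivable].
Qed.

Lemma is_derive_line (F : V -> R) (x v : V) (s : R) :
  (forall y, differentiable F y) ->
  is_derive s 1 (fun r => F (x + r *: v)) (dot (gradient F (x + s *: v)) v).
Proof.
move=> dF; have dFs := diff_derivable (v:=v) (dF (x + s *: v)).
have E : (fun h : R => h^-1 *: (((fun r => F (x + r *: v)) \o shift s) (h *: 1)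
      - F (x + s *: v)))
    = (fun h => h^-1 *: ((F \o shift (x + s *: v)) (h *: v) - F (x + s *: v))).
  apply/funext => h /=.
  by rewrite [_%:A]mulr1 scalerDl addrCA.
apply: DeriveDef; first by rewrite /derivable E.
by rewrite -derive_dot_gradient// /derive E.
Qed.

Definition bregman (F : V -> R) (u v : V) : R :=
  F u - F v - dot (gradient F v) (u - v).

Definition lipschitz_gradient (N : V -> R) (K : R) (F : V -> R) : Prop :=
  forall x y, dual_norm N (gradient F x - gradient F y) <= K * N (x - y).

Section smooth.
Variables (N : V -> R) (normN : is_norm N) (K : R) (F : V -> R).
Hypotheses (dF : forall x, differentiable F x) (lipF : lipschitz_gradient N K F).

(** The mean value theorem along the segment from v to u replaces the usual integral of the
    gradient. *)
Lemma bregman_smooth (u v : V) : `|bregman F u v| <= K / 2 * N (u - v) ^+ 2.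
Proof.
set w := u - v; set c := K * N w ^+ 2; pose g (r : R) :=  F (v + r *: w).
have key (r : R) : 0 <= r -> `|dot (gradient F (v + r *: w) - gradient F v) w| <= r * c.
  move=> r0; have h a b : dot (gradient F a - gradient F b) w <= K * N (a - b) * N w.
    apply: le_trans (dot_le_dual_norm normN _ _) _.
    by rewrite ler_wpM2r ?norm_nonneg.
  have := h (v + r *: w) v; have := h v (v + r *: w).
  rewrite opprD addNKr norm_opp// (addrAC v) subrr add0r (norm_scale normN) ger0_norm//.
  rewrite !dotE ler_norml => h1 h2; rewrite /c; apply/andP; split; lra.
(* The sign [a] treats the upper and the lower bound at once: by [key], [q] has a nonpositive
   derivative on the open unit interval. *)
have main (a : R) : a = 1 \/ a = -1 -> a * bregman F u v <= c / 2.
  move=> a1; pose q r : R := a * g r - (a * r * dot (gradient F v) w + c / 2 * r ^+ 2).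
  pose dq r := a * dot (gradient F (v + r *: w)) w - (a * dot (gradient F v) w + c * r).
  have dqP (r : R) : is_derive r 1 q (dq r).
    have dg : is_derive r 1 g (dot (gradient F (v + r *: w)) w).
      exact: is_derive_line.
    have -> : q = a *: g - ((a * dot (gradient F v) w) *: id + (c / 2) *: id ^+ 2).
      by apply/funext => t; rewrite /q mulrAC.
    apply: is_derive_eq; rewrite /dq /GRing.scale/=.
    by field.

  have cq : {within `[0, 1], continuous q}.
    apply: continuous_subspaceT => r.
    by apply: differentiable_continuous; apply/derivable1_diffP.
  have [r] := MVT ltr01 (fun r _ => dqP r) cq.
  rewrite in_itv/= => /andP[r0 r1]; rewrite subr0 mulr1 => E.
  have : q 1 - q 0 <= 0.
    rewrite E /dq; have /ler_normlP := key r (ltW r0).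
    rewrite !dotE => -[h1 h2].
    by case: a1 => ->; lra.
  rewrite /q /g /bregman scale1r scale0r addr0 (addrC v) subrK; lra.
have := main 1 (or_introl erefl); have := main (-1) (or_intror erefl).
by rewrite /c ler_norml => h1 h2; apply/andP; split; lra.
Qed.

End smooth.
End calculus.

(** * Convexity *)

Section convexity.
Context {R : realType} {n : nat}.
Local Notation V := 'rV[R]_n.
Implicit Types (X : set V) (F G : V -> R).

Lemma convex_setP X (x y : V) (s : R) : convex_set X -> X x -> X y ->
  0 <= s <= 1 -> X (s *: x + (1 - s) *: y).
Proof.
move=> cX Xx Xy /andP[s0 s1].
by have := cX x y (Itv01 s0 s1); rewrite !inE; exact.
Qed.

Lemma convex_functionP X F (x y : V) (s : R) : convex_function X F ->
  X x -> X y -> 0 <= s <= 1 ->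
  F (s *: x + (1 - s) *: y) <= s * F x + (1 - s) * F y.
Proof.
move=> cF Xx Xy /andP[s0 s1].
by have := cF (Itv01 s0 s1) x y; rewrite !inE; exact.
Qed.

Lemma convex_functionI X F :
  (forall x y s, X x -> X y -> 0 <= s <= 1 ->
     F (s *: x + (1 - s) *: y) <= s * F x + (1 - s) * F y) -> convex_function X F.
Proof.
move=> cF t x y /[!inE] Xx Xy; apply: cF => //.
by apply/andP; split.
Qed.

(** Let s tend to 0. First-order conditions are derived below by dividing an inequality on a segment
    by s and applying this. *)
Lemma le_affine_limit (a b c : R) :
  (forall s, 0 < s <= 1 -> a <= b + s * c) -> a <= b.
Proof.
move=> h; case: (leP a b) => // ba.
have c1 : 0 < `|c| + 1 by rewrite ltr_wpDl.
(* Small enough that [s * c] is at most half of [a - b], which contradicts b < a. *)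
pose s := Num.min 1 ((a - b) / (2 * (`|c| + 1))).
have s0 : 0 < s by rewrite lt_min ltr01 divr_gt0 ?subr_gt0 ?mulr_gt0.
have s1 : s <= 1 by rewrite ge_min lexx.
have : s * c <= (a - b) / 2.
  apply: le_trans (_ : s * (`|c| + 1) <= _).
    by rewrite (ler_wpM2l (ltW s0))// (le_trans (ler_norm c))// lerDl.
  rewrite -ler_pdivlMr// ge_min; apply/orP; right.
  by rewrite invfM mulrA.
have := h s; rewrite s0 s1 => /(_ isT); lra.
Qed.

Lemma strongly_convex_add N (sigma mu : R) X F G : 0 <= mu ->
  convex_function X F -> strongly_convex N sigma X G ->
  strongly_convex N (mu * sigma) X (fun x => F x + mu * G x).
Proof.
move=> mu0 cF cG x y t Xx Xy t01.
have hF := convex_functionP cF Xx Xy t01.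
by have := ler_wpM2l mu0 (cG x y t Xx Xy t01); lra.
Qed.

(** Compare strong convexity with the subgradient inequality at the point x + s (y - x), divide by s
    and let s tend to 0. *)
Lemma le_prox N sigma X omega (g x y : V) :
  is_norm N -> convex_set X -> strongly_convex N sigma X omega ->
  X x -> X y -> subdifferential X omega x g ->
  sigma / 2 * N (y - x) ^+ 2 <= prox omega g x y.
Proof.
move=> normN cX scF Xx Xy sub.
apply: (@le_affine_limit _ _ (sigma / 2 * N (y - x) ^+ 2)) => s /andP[s0 s1].
have s01 : 0 <= s <= 1 by rewrite ltW.
have := sub _ (convex_setP cX Xy Xx s01); have := scF y x s Xy Xx s01.
have -> : s *: y + (1 - s) *: x - x = s *: (y - x).
  by rewrite scalerBl scale1r addrCA addrAC subrr add0r scalerBr.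
rewrite dotZr /prox => h1 h2; rewrite -(ler_pM2l s0); lra.
Qed.

Section smooth_convex.
Variables (N : V -> R) (normN : is_norm N) (K : R) (F : V -> R).
Hypotheses (dF : forall x, differentiable F x) (lipF : lipschitz_gradient N K F).

(** At v + s (u - v) the linearization error is of order s^2 by [bregman_smooth]; it disappears
    after division by s. *)
Lemma convex_smooth_bregman_ge0 (u v : V) : convex_function setT F ->
  0 <= bregman F u v.
Proof.
move=> cF; apply: (@le_affine_limit _ _ (K / 2 * N (u - v) ^+ 2)) => s /andP[s0 s1].
have s01 : 0 <= s <= 1 by rewrite ltW.
have h1 := convex_functionP cF (I : setT u) (I : setT v) s01.
have /ler_normlP[+ _] := bregman_smooth normN dF lipF (s *: u + (1 - s) *: v) v.
rewrite /bregman.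
have -> : s *: u + (1 - s) *: v - v = s *: (u - v).
  by rewrite scalerBl scale1r addrCA addrAC subrr add0r scalerBr.
rewrite dotZr (norm_scale normN) gtr0_norm// => h2.
by rewrite -(ler_pM2l s0) mulr0; lra.
Qed.

(* The convex smooth F lies between its linearization at v and its quadratic
   upper model at u; comparing the two at the point u - s w gives the claim. *)
Lemma gradient_young (u v w : V) (s : R) : convex_function setT F -> 0 < s ->
  dot (gradient F u - gradient F v) w
    <= bregman F u v / s + K * s / 2 * N w ^+ 2.
Proof.
move=> cF s0.
have h1 := convex_smooth_bregman_ge0 (u - s *: w) v cF.
have /ler_normlP[_] := bregman_smooth normN dF lipF (u - s *: w) u.
rewrite addrAC subrr add0r norm_opp// (norm_scale normN) gtr0_norm// => h2.
rewrite -(ler_pM2l s0) mulrDr (mulrCA s) divff ?gt_eqF// mulr1.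
move: h1 h2; rewrite /bregman !dotE; lra.
Qed.

(** Minimality of x is tested on the segment towards y, with F expanded up to a quadratic error and
    G bounded by strong convexity; after division by s the error is of order s. *)
Lemma composite_min_growth X (G : V -> R) (sigma : R) (x y : V) :
  convex_set X -> strongly_convex N sigma X G ->
  is_argmin X (fun z => F z + G z) x -> X y ->
  sigma / 2 * N (y - x) ^+ 2 <= dot (gradient F x) (y - x) + G y - G x.
Proof.
move=> cX scG [Xx minx] Xy.
apply: (@le_affine_limit _ _ ((sigma + K) / 2 * N (y - x) ^+ 2)) => s /andP[s0 s1].
have s01 : 0 <= s <= 1 by rewrite ltW.
have h1 := scG y x s Xy Xx s01; have h2 := minx _ (convex_setP cX Xy Xx s01).
have /ler_normlP[_] := bregman_smooth normN dF lipF (s *: y + (1 - s) *: x) x.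
rewrite /bregman.
have -> : s *: y + (1 - s) *: x - x = s *: (y - x).
  by rewrite scalerBl scale1r addrCA addrAC subrr add0r scalerBr.
rewrite dotZr (norm_scale normN) gtr0_norm// => h3.
rewrite -(ler_pM2l s0); lra.
Qed.

End smooth_convex.

Lemma prox_ge0 N sigma X omega (g x y : V) : 0 <= sigma ->
  is_norm N -> convex_set X -> strongly_convex N sigma X omega ->
  X x -> X y -> subdifferential X omega x g -> 0 <= prox omega g x y.
Proof.
move=> s0 normN cX sc Xx Xy sub.
by apply: le_trans (le_prox normN cX sc Xx Xy sub); rewrite mulr_ge0 ?divr_ge0 ?sqr_ge0.
Qed.

Lemma bregman_sum m (f : 'I_m -> V -> R) (u v : V) :
  (forall i x, differentiable (f i) x) ->
  bregman (fun x => \sum_i f i x) u v = \sum_i bregman (f i) u v.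
Proof.
by move=> df; rewrite /bregman gradient_sum// dot_suml !sumrB.
Qed.

End convexity.

(** * One iteration *)

Section one_step.
Context {R : realType} {n m : nat}.
Local Notation V := 'rV[R]_n.
Variables (N : V -> R) (X : set V) (f : 'I_m -> V -> R) (Ls : 'I_m -> R).
Variables (hhat omega : V -> R) (p : 'I_m -> R) (mu tau eta alpha : R) (xs : V).
Hypotheses (normN : is_norm N) (cX : convex_set X).
Hypotheses (cf : forall i, convex_function setT (f i))
  (df : forall i x, differentiable (f i) x)
  (lipf : forall i, lipschitz_gradient N (Ls i) (f i)).
Hypotheses (scomega : strongly_convex N 1 X omega) (Xxs : X xs).
Hypotheses (Ls0 : forall i, 0 <= Ls i) (p0 : forall i, 0 < p i) (p1 : \sum_i p i = 1).
Hypotheses (tau0 : 0 < tau) (eta0 : 0 < eta) (alpha01 : 0 <= alpha <= 1).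
Hypotheses (contr_dual : forall i, (1 - alpha) * (1 + tau) <= p i)
  (contr_primal : eta <= alpha * (eta + mu))
  (coupling : forall i, 4 * Ls i <= eta * tau * p i).

Implicit Types (x y g : V) (u : 'I_m -> V).

(** The gap of the saddle-point form with the dual variable frozen at the gradient at [xs]. For
    convex [hhat] and [omega] it is convex in x, so it passes to averages of iterates. *)
Definition linear_gap x : R :=
  dot (gradient (fun y => \sum_i f i y) xs) (x - xs)
  + (hhat x + mu * omega x) - (hhat xs + mu * omega xs).

Definition rpdg_potential x xprev u g : R :=
  (eta + mu) * prox omega g x xs
  + (1 + tau) * \sum_i (p i)^-1 * bregman (f i) (u i) xs
  + dot (\sum_i gradient (f i) (u i) - \sum_i gradient (f i) xs) (x - xprev)
  + eta / 4 * N (x - xprev) ^+ 2.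

(** The term in [g' - g] is exactly a difference of three Bregman distances of [omega], and
    [mu *: g'] produces the additional [mu] in front of the distance from x' to w. *)
Lemma prox_three_points y x g x' g' hg w :
  subdifferential X hhat x' hg -> X w ->
  0 <= dot (y + hg + mu *: g' + eta *: (g' - g)) (w - x') ->
  dot y (x' - w) + (hhat x' + mu * omega x') - (hhat w + mu * omega w)
  <= eta * prox omega g x w - (eta + mu) * prox omega g' x' w
     - eta * prox omega g x x'.
Proof. by move=> /(_ w) + Xw => /(_ Xw); rewrite /prox !dotE; lra. Qed.

Let xtilde x xprev : V := alpha *: (x - xprev) + x.
Let uhat x xprev u i : V := (1 + tau)^-1 *: (xtilde x xprev + tau *: u i).

(* Optimality of the dual prox-step at the point uhat, which satisfies
   xtilde - uhat = tau (uhat - u_i). *)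
Lemma dual_step x xprev u i (uh := uhat x xprev u i) :
  dot (gradient (f i) xs - gradient (f i) uh) (xtilde x xprev - xs)
  + (1 + tau) * bregman (f i) uh xs + tau * bregman (f i) (u i) uh
  <= tau * bregman (f i) (u i) xs.
Proof.
have D := convex_smooth_bregman_ge0 normN (df i) (@lipf i) xs uh (cf i).
have E : xtilde x xprev = (1 + tau) *: uh - tau *: u i.
  by rewrite /uh /uhat scalerA divff ?scale1r ?addrK// gt_eqF// ltr_wpDl.
by move: D; rewrite E /bregman !dotE; lra.
Qed.

(** The step for a fixed draw j. Put q = 1 / p j. The extrapolation in [xtilde] cancels the coupling
    terms up to -(q - 1) <r, x' - x> and alpha q <r, x - xprev>, which are split by
    [gradient_young]. Half of eta P(x, x') >= eta/2 |x' - x|^2 pays for the first quadratic part,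
    and the other half is the displacement term of the new potential; the old displacement term pays
    for the second. *)
Lemma primal_dual_branch x xprev u g j x' g' hg
    (uh := uhat x xprev u j) (r := gradient (f j) uh - gradient (f j) (u j))
    (u' := fun i => if i == j then uh else u i)
    (yt := \sum_i gradient (f i) (u i) + (p j)^-1 *: r) :
  X x -> X x' -> subdifferential X omega x g ->
  subdifferential X hhat x' hg ->
  (forall w, X w ->
    0 <= dot (yt + hg + mu *: g' + eta *: (g' - g)) (w - x')) ->
  linear_gap x' + rpdg_potential x' x u' g'
  <= eta * prox omega g x xs
   + (1 + tau) * ((\sum_i (p i)^-1 * bregman (f i) (u i) xs)
      + (p j)^-1 * (bregman (f j) uh xs - bregman (f j) (u j) xs))
   + (p j)^-1 * tau * bregman (f j) (u j) uh
   + alpha * (dot (\sum_i gradient (f i) (u i) - \sum_i gradient (f i) xs) (x - xprev)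
              + eta / 4 * N (x - xprev) ^+ 2)
   - dot (yt - \sum_i gradient (f i) xs) (xtilde x xprev - xs).
Proof.
move=> Xx Xx' subg subhg opt.
have h1 := prox_three_points x subhg Xxs (opt xs Xxs).
have h2 := le_prox normN cX scomega Xx Xx' subg.
set S := \sum_i _ * _.
have ES : \sum_i (p i)^-1 * bregman (f i) (u' i) xs
    = S + (p j)^-1 * (bregman (f j) uh xs - bregman (f j) (u j) xs).
  rewrite /S (bigD1 j)//= [in RHS](bigD1 j)//= /u' eqxx.
  under eq_bigr => i /negPf-> do [].
  ring.
have EY : \sum_i gradient (f i) (u' i) = \sum_i gradient (f i) (u i) + r.
  rewrite (bigD1 j)//= [in RHS](bigD1 j)//= /u' eqxx.
  under eq_bigr => i /negPf-> do [].
  by rewrite /r addrAC addrCA subrr addr0.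
have q1 : 0 <= (p j)^-1 - 1.
  rewrite subr_ge0 invf_ge1// -p1 (bigD1 j)//= lerDl sumr_ge0// => i _.
  exact: ltW.
(* Here the coupling condition turns the quadratic part of Young's inequality into a displacement
   term. *)
have c1 : (p j)^-1 * Ls j / tau <= eta / 4.
  rewrite ler_pdivrMr// mulrC ler_pdivrMr//; have := coupling j; lra.
(* With Young parameter 2 / tau each use costs half of the divergence [tau * b] that [dual_step]
   leaves available. *)
have s0 : 0 < 2 / tau by rewrite divr_gt0.
have y1 := gradient_young normN (df j) (@lipf j) (u j) uh (x' - x) (cf j) s0.
have y2 := gradient_young normN (df j) (@lipf j) (u j) uh (- (x - xprev)) (cf j) s0.
rewrite (norm_opp normN) in y2.
have e0 := convex_smooth_bregman_ge0 normN (df j) (@lipf j) (u j) uh (cf j).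
have invs : (2 / tau)^-1 = tau / 2 by rewrite invf_div.
have Ls1 : Ls j * (2 / tau) / 2 = Ls j / tau by field; rewrite gt_eqF.
rewrite invs Ls1 in y1 y2.
have {}y1 := ler_wpM2l q1 y1.
have aq0 : 0 <= alpha * (p j)^-1.
  by rewrite mulr_ge0 ?invr_ge0 ?(ltW (p0 _))//; case/andP: alpha01.
have {}y2 := ler_wpM2l aq0 y2.
rewrite /linear_gap gradient_sum// /rpdg_potential ES EY.
move: h1 h2 y1 y2; rewrite /yt /r /xtilde !dotE.
set b := bregman (f j) (u j) uh in e0 *.
set q := (p j)^-1 in q1 aq0 c1 *.
set a' := N (x' - x) ^+ 2; set a := N (x - xprev) ^+ 2.
have a'0 : 0 <= a' by exact: sqr_ge0.
have a0 : 0 <= a by exact: sqr_ge0.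
case/andP: alpha01 => alpha0 alpha1.
have k1 : (q - 1) * (Ls j / tau * a') <= eta / 4 * a'.
  have := ler_wpM2r a'0 c1; have : 0 <= Ls j / tau * a' by rewrite mulr_ge0// divr_ge0// ltW.
  lra.
have k2 := ler_wpM2l alpha0 (ler_wpM2r a0 c1).
(* Both halves fit because q - 1 <= q and alpha <= 1. *)
have k3 : (q - 1) * (b * (tau / 2)) + alpha * q * (b * (tau / 2)) <= q * tau * b.
  have tb : 0 <= tau * b by rewrite mulr_ge0// ltW.
  have : alpha * (q * (tau * b)) <= q * (tau * b).
    by rewrite ler_piMl// mulr_ge0// -(subrK 1 q) addr_ge0.
  lra.
move=> h1 /(ler_wpM2l (ltW eta0)) h2 y1 y2; lra.
Qed.

(** The old state is fixed and only the draw j is averaged. The two contraction conditions then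
    shrink the primal distance and the dual divergences by the factor alpha. *)
Lemma expected_one_step x xprev u g (x' : 'I_m -> V) (g' : 'I_m -> V)
    (u' : 'I_m -> 'I_m -> V) (hg : 'I_m -> V)
    (yt := fun j => \sum_i gradient (f i) (u i)
       + (p j)^-1 *: (gradient (f j) (u' j j) - gradient (f j) (u j))) :
  X x -> (forall j, X (x' j)) -> subdifferential X omega x g ->
  (forall j i, u' j i = if i == j then uhat x xprev u j else u i) ->
  (forall j, subdifferential X hhat (x' j) (hg j)) ->
  (forall j w, X w -> 0 <= dot (yt j + hg j + mu *: g' j + eta *: (g' j - g)) (w - x' j)) ->
  \sum_j p j * (linear_gap (x' j) + rpdg_potential (x' j) x (u' j) (g' j))
  <= alpha * rpdg_potential x xprev u g.
Proof.
move=> Xx Xx' subg Eu' subhg opt.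
(* The weight p j cancels the inverse probability, so [dual_step] applies to the drawn component.
   The last line sums over j to the full gradient difference, which cancels the common term in
   [xtilde]. *)
have step j : p j * (linear_gap (x' j) + rpdg_potential (x' j) x (u' j) (g' j))
  <= p j * (eta * prox omega g x xs
     + (1 + tau) * (\sum_i (p i)^-1 * bregman (f i) (u i) xs)
     + alpha * (dot (\sum_i gradient (f i) (u i) - \sum_i gradient (f i) xs) (x - xprev)
                + eta / 4 * N (x - xprev) ^+ 2)
     - dot (\sum_i gradient (f i) (u i) - \sum_i gradient (f i) xs) (xtilde x xprev - xs))
    + (dot (gradient (f j) (u j) - gradient (f j) xs) (xtilde x xprev - xs)
       - bregman (f j) (u j) xs).
  have := primal_dual_branch Xx (Xx' j) subg (subhg j).
  move/(_ xprev u j (g' j)).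
  have <- : (u' j) = (fun i => if i == j then uhat x xprev u j else u i).
    by apply/funext => i; rewrite Eu'.
  have -> : uhat x xprev u j = u' j j by rewrite Eu' eqxx.
  move=> /(_ (opt j)) /(ler_wpM2l (ltW (p0 j))).
  have := dual_step x xprev u j.
  have -> : uhat x xprev u j = u' j j by rewrite Eu' eqxx.
  rewrite -/(yt j) => h1 h2; apply: le_trans h2 _.
  move: h1; rewrite /yt.
  set Y := \sum_i gradient (f i) (u i); set Ys := \sum_i gradient (f i) xs.
  set z := xtilde x xprev - xs.
  set S := \sum_i _ * _; set c := dot (Y - Ys) (x - xprev) + _.
  clearbody z Y Ys; rewrite !(dotBl, dotDl, dotZl) => h1.
  set b := bregman (f j) (u' j j) xs in h1 *; set D := bregman (f j) (u j) xs in h1 *.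
  set e := bregman (f j) (u j) (u' j j) in h1 *.
  set q := (p j)^-1.
  have pq a : p j * (q * a) = a by rewrite mulrA mulfV ?mul1r// gt_eqF.
  have := pq ((1 + tau) * (b - D) + tau * e
              - (dot (gradient (f j) (u' j j)) z - dot (gradient (f j) (u j)) z)).
  lra.
apply: le_trans (ler_sum _ (fun j _ => step j)) _.
rewrite big_split/= -mulr_suml p1 mul1r.
rewrite sumrB -dot_suml sumrB /rpdg_potential.
(* Termwise this is (1 + tau) - p i <= alpha (1 + tau), the dual contraction. *)
have h1 : (1 + tau) * (\sum_i (p i)^-1 * bregman (f i) (u i) xs) - \sum_i bregman (f i) (u i) xs
    <= alpha * ((1 + tau) * \sum_i (p i)^-1 * bregman (f i) (u i) xs).
  rewrite !mulr_sumr -sumrB; apply: ler_sum => i _.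
  set D := bregman _ _ _.
  have D0 : 0 <= (p i)^-1 * D.
    rewrite mulr_ge0 ?invr_ge0 ?(ltW (p0 i))//.
    exact: (convex_smooth_bregman_ge0 normN (df i) (@lipf i)).
  have : D = p i * ((p i)^-1 * D) by rewrite mulrA mulfV ?mul1r// gt_eqF.
  have := ler_wpM2r D0 (contr_dual i); lra.
have h2 := ler_wpM2r (prox_ge0 ler01 normN cX scomega Xx Xxs subg) contr_primal.
lra.
Qed.

(* Nonnegativity holds because the coupling term is absorbed by the dual
   divergences (through gradient_young) and by the displacement term. *)
Lemma rpdg_potential_ge0 x xprev u g : 0 <= mu -> X x -> subdifferential X omega x g ->
  0 <= rpdg_potential x xprev u g.
Proof.
move=> mu0 Xx subg.
have s0 : 0 < 2 / tau by rewrite divr_gt0.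
have invs : (2 / tau)^-1 = tau / 2 by rewrite invf_div.
(* The displacement term is shared among the components in proportion to p i, matching the coupling
   condition. *)
have h1 : - dot (\sum_i gradient (f i) (u i) - \sum_i gradient (f i) xs) (x - xprev)
   <= \sum_i ((1 + tau) * ((p i)^-1 * bregman (f i) (u i) xs))
      + \sum_i p i * (eta / 4 * N (x - xprev) ^+ 2).
  rewrite -sumrB dot_suml -sumrN -big_split; apply: ler_sum => i _ /=.
  rewrite -dotNr.
  apply: le_trans (gradient_young normN (df i) (@lipf i) (u i) xs _ (cf i) s0) _.
  rewrite (norm_opp normN) invs; apply: lerD.
    have D0 := convex_smooth_bregman_ge0 normN (df i) (@lipf i) (u i) xs (cf i).
    rewrite [leRHS]mulrA [leRHS]mulrC ler_wpM2l//.
    have : 1 <= (p i)^-1.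
      rewrite invf_ge1// -p1 (bigD1 i)//= lerDl sumr_ge0// => k _; exact: ltW.
    move=> q1; have := ler_wpM2r (ltW tau0) q1; move: tau0; lra.
  rewrite mulrA ler_wpM2r ?sqr_ge0//.
  have -> : Ls i * (2 / tau) / 2 = Ls i / tau by field; rewrite gt_eqF.
  rewrite ler_pdivrMr//; have := coupling i; lra.
rewrite -mulr_suml p1 mul1r -mulr_sumr in h1.
have := prox_ge0 ler01 normN cX scomega Xx Xxs subg.
rewrite /rpdg_potential.
have : 0 <= eta + mu by rewrite addr_ge0// ltW.
move=> e1 /(mulr_ge0 e1); lra.
Qed.

End one_step.

(** * Words of draws and trajectories *)

Section words.
Context {R : realType} {m k : nat} (p : 'I_m -> R).
Implicit Types (w : {ffun 'I_k -> 'I_m}).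

Definition word_weight w : R := \prod_t p (w t).

Definition redraw w (t : 'I_k) (j : 'I_m) : {ffun 'I_k -> 'I_m} :=
  [ffun s => if s == t then j else w s].

Lemma word_weight_ge0 w : (forall j, 0 < p j) -> 0 <= word_weight w.
Proof. by move=> p0; apply: prodr_ge0 => t _; exact: ltW. Qed.

Lemma redraw_weight w t j : word_weight (redraw w t j) * p (w t) = word_weight w * p j.
Proof.
rewrite /word_weight (bigD1 t)//= [X in _ = X * _](bigD1 t)//= ffunE eqxx.
under eq_bigr => s /negPf st do rewrite ffunE st.
ring.
Qed.

(** Resampling one letter preserves the product law: exchanging letter t with the fresh letter is an
    involution that preserves the joint weight. This plays the role of conditioning on the other
    draws. *)
Lemma redraw_weight_sum (H : {ffun 'I_k -> 'I_m} -> R) t : \sum_j p j = 1 ->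
  \sum_w word_weight w * (\sum_j p j * H (redraw w t j)) = \sum_w word_weight w * H w.
Proof.
move=> p1.
pose sw (a : {ffun 'I_k -> 'I_m} * 'I_m) := (redraw a.1 t a.2, a.1 t).
have swK : involutive sw.
  move=> [w j]; rewrite /sw /= ffunE eqxx; congr pair.
  by apply/ffunP => s; rewrite !ffunE; case: eqP => // ->.
transitivity (\sum_(a : {ffun 'I_k -> 'I_m} * 'I_m) word_weight a.1 * p a.2 * H a.1).
  under eq_bigr do rewrite mulr_sumr.
  rewrite pair_bigA [RHS](reindex_inj (inv_inj swK)).
  by apply: eq_bigr => -[w j] _ /=; rewrite redraw_weight mulrA.
rewrite -(pair_bigA _ (fun w j => word_weight w * p j * H w))/=.
apply: eq_bigr => w _; under eq_bigr do rewrite mulrAC.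
by rewrite -mulr_sumr p1 mulr1.
Qed.

Lemma word_weight_sum : \sum_j p j = 1 -> \sum_w word_weight w = 1.
Proof.
move=> p1; rewrite /word_weight -(bigA_distr_bigA (fun _ j => p j)).
by rewrite big1.
Qed.

End words.

Section averages.
Context {R : realType} {n : nat}.
Local Notation V := 'rV[R]_n.
Variables (X : set V) (F : V -> R) (theta : nat -> R) (x : nat -> V).
Hypotheses (cX : convex_set X) (cF : convex_function X F).
Hypothesis theta0 : forall t, 0 < theta t.

(** Jensen's inequality by induction: the new average combines the old one and the new point with
    coefficient S / (S + th). Membership is carried along because convexity of F is known on X
    only. *)
Lemma weighted_average_convex k : (0 < k)%N ->
  (forall t, (0 < t <= k)%N -> X (x t)) ->
  let S := \sum_(1 <= t < k.+1) theta t in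
  let xbar := S^-1 *: \sum_(1 <= t < k.+1) theta t *: x t in
  X xbar /\ F xbar <= S^-1 * \sum_(1 <= t < k.+1) theta t * F (x t).
Proof.
case: k => // k _; elim: k => [|k IH] Xx.
  rewrite /= !big_nat1 scalerA mulrA mulVf ?gt_eqF// scale1r mul1r.
  by split => //; apply: Xx.
have {IH}[t /andP[t0 tk]| /= Xb Fb] := IH; first by apply: Xx; rewrite t0 ltnW.
rewrite /= (big_nat_recr k.+2)//= (big_nat_recr k.+2)//= (big_nat_recr k.+2)//=.
set S := \sum_(1 <= t < k.+2) _ in Xb Fb *.
set A := \sum_(1 <= t < k.+2) _ *: _ in Xb Fb *.
set B := \sum_(1 <= t < k.+2) _ * _ in Fb *.
set th := theta k.+2.
have th0 : 0 < th := theta0 _.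
have S0 : 0 < S.
  by rewrite /S big_nat_recr//= ltr_wpDl// sumr_ge0// => t _; exact: ltW.
have ST : 0 < S + th by rewrite addr_gt0.
pose s := S / (S + th).
have s01 : 0 <= s <= 1.
  by rewrite /s ler_pdivrMr// mul1r lerDl !ltW// divr_gt0.
have s1 : 1 - s = th / (S + th) by rewrite /s; field; rewrite gt_eqF.
have -> : (S + th)^-1 *: (A + th *: x k.+2) = s *: (S^-1 *: A) + (1 - s) *: x k.+2.
  rewrite s1 scalerDr !scalerA /s; congr (_ *: _ + _ *: _); field;
  by rewrite ?gt_eqF// gt_eqF.
have Xk : X (x k.+2) by apply: Xx => /=.
split; first exact: convex_setP.
apply: le_trans (convex_functionP cF Xb Xk s01) _.
have -> : (S + th)^-1 * (B + th * F (x k.+2)) = s * (S^-1 * B) + (1 - s) * F (x k.+2).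
  rewrite s1 mulrDr !mulrA /s; congr (_ * _ + _ * _); field;
  by rewrite ?gt_eqF// gt_eqF.
by rewrite lerD2r ler_wpM2l//; case/andP: s01.
Qed.

End averages.

Section trajectories.
Context {R : realType} {n m : nat}.
Local Notation V := 'rV[R]_n.
Variables (N : V -> R) (X : set V) (f : 'I_m -> V -> R).
Variables (hhat omega : V -> R) (p : 'I_m -> R) (mu tau eta alpha : R) (x0 g0 : V).
Variable (k : nat).
Hypotheses (normN : is_norm N) (cX : convex_set X).
Hypotheses (scomega : strongly_convex N 1 X omega) (Xx0 : X x0)
  (subg0 : subdifferential X omega x0 g0) (mu0 : 0 < mu) (eta0 : 0 < eta).

Local Notation traj := (rpdg_trajectory X f hhat omega mu p tau eta alpha x0 g0 k).

Section one_trajectory.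
Variables (i_ : nat -> 'I_m) (z : trajectory R n m) (Hz : traj i_ z).

Lemma trajectory_mem t : (t <= k)%N -> X (rx z t).
Proof.
case: t => [_|t tk]; first by rewrite (rpdg_x0 Hz).
by case: (rpdg_x Hz tk).
Qed.

Lemma trajectory_subdifferential t : (t <= k)%N ->
  subdifferential X omega (rx z t) (rg z t).
Proof.
case: t => [_|t tk]; first by rewrite (rpdg_x0 Hz) (rpdg_g0 Hz).
exact: (rpdg_g Hz tk).
Qed.

Lemma trajectory_output_mem : (0 < k)%N -> 0 < alpha -> X (rpdg_output alpha k z).
Proof.
move=> k0 alpha0.
have theta0 t : 0 < alpha ^- t by rewrite invr_gt0 exprn_gt0.
(* Only membership is wanted, so the averaging lemma is applied to the zero function. *)
have c0 : convex_function X (fun=> 0).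
  by apply: convex_functionI => x y s _ _ _; rewrite !mulr0 addr0.
have [//|t /andP[t0 tk]|//] := @weighted_average_convex _ _ X _ _ (rx z) cX c0 theta0 k.
exact: trajectory_mem.
Qed.

Lemma trajectory_gradient t i : (t <= k)%N -> ry z t i = gradient (f i) (rxu z t i).
Proof.
elim: t => [_|t IH tk]; first by rewrite (rpdg_y0 Hz) (rpdg_xu0 Hz).
rewrite (rpdg_y Hz i tk); case: ifPn => // it.
by rewrite (rpdg_xu Hz i tk) (negPf it) IH// ltnW.
Qed.

(** This rewrites the dual estimate as the [yt] of the one-step inequalities. *)
Lemma trajectory_dual_sum t (j := i_ t.+1) : (t < k)%N ->
  \sum_i ryt z t.+1 i = \sum_i gradient (f i) (rxu z t i)
    + (p j)^-1 *: (gradient (f j) (rxu z t.+1 j) - gradient (f j) (rxu z t j)).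
Proof.
move=> tk; rewrite (bigD1 j)//= [in RHS](bigD1 j)//=.
rewrite (rpdg_yt Hz j tk) eqxx !trajectory_gradient ?(ltnW tk)//.
under eq_bigr => i ij do
  rewrite (rpdg_yt Hz i tk) (negPf ij) trajectory_gradient ?(ltnW tk)//.
by rewrite [RHS]addrC addrA.
Qed.

End one_trajectory.

(** The subproblem is strongly convex, so its minimizer is unique and a run is determined by its
    draws and its subgradients. *)
Lemma trajectory_unique i_ i_' z z' t : traj i_ z -> traj i_' z' -> (t <= k)%N ->
  (forall r, (0 < r <= t)%N -> i_ r = i_' r) ->
  (forall r, (r <= t)%N -> rg z r = rg z' r) ->
  rx z t = rx z' t /\ rxu z t =1 rxu z' t.
Proof.
move=> Hz Hz'.
(* The induction also carries the preceding iterate, which the extrapolation reads. *)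
suff H : (t <= k)%N -> (forall r, (0 < r <= t)%N -> i_ r = i_' r) ->
   (forall r, (r <= t)%N -> rg z r = rg z' r) ->
   [/\ rx z t = rx z' t, rx z t.-1 = rx z' t.-1 & rxu z t =1 rxu z' t].
  by move=> tk hi hg; case: (H tk hi hg).
elim: t => [_ _ _|t IH tk hi hg].
  by split=> [||i]; rewrite ?(rpdg_x0 Hz) ?(rpdg_x0 Hz') ?(rpdg_xu0 Hz) ?(rpdg_xu0 Hz').
have [r /andP[r0 rt]|r rt|ex exp eu] := IH (ltnW tk).
- by apply: hi; rewrite r0 leqW.
- by apply: hg; rewrite leqW.
have it : i_ t.+1 = i_' t.+1 by apply: hi; rewrite leqnn.
have eu1 : rxu z t.+1 =1 rxu z' t.+1.
  by move=> i; rewrite (rpdg_xu Hz i tk) (rpdg_xu Hz' i tk) it ex exp eu.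
split=> //.
have ey : \sum_i ryt z t.+1 i = \sum_i ryt z' t.+1 i.
  rewrite (trajectory_dual_sum Hz tk) (trajectory_dual_sum Hz' tk) it eu eu1.
  by congr (_ + _); apply: eq_bigr => i _; rewrite eu.
have [hg1 sub1 opt1] := rpdg_optimality Hz tk.
have [X1 _] := rpdg_x Hz tk; have [X2 min2] := rpdg_x Hz' tk.
(* The optimality condition of the first minimizer is tested at the second; minimality of the second
   then forces their Bregman distance to be at most 0. *)
have h := prox_three_points omega (rx z t) sub1 X2 (opt1 _ X2).
have := min2 _ X1; rewrite -ey -ex -hg// => h2.
have := le_prox normN cX scomega X1 X2 (rpdg_g Hz tk).
move: h; rewrite !dotE => h h3.
have : N (rx z' t.+1 - rx z t.+1) ^+ 2 <= 0.
  have me0 : 0 < eta + mu by rewrite addr_gt0.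
  have := ler_wpM2l (ltW me0) h3.
  rewrite -(pmulr_rle0 _ me0); lra.
rewrite exprn_even_le0//= => /eqP/(norm_definite normN)/eqP.
by rewrite subr_eq0 => /eqP.
Qed.

End trajectories.

(** * Descent of the potential in expectation, for runs indexed by words *)

Section expected_descent.
Context {R : realType} {n m : nat}.
Local Notation V := 'rV[R]_n.
Variables (N : V -> R) (X : set V) (f : 'I_m -> V -> R) (Ls : 'I_m -> R).
Variables (hhat omega : V -> R) (p : 'I_m -> R) (mu tau eta alpha : R) (xs x0 g0 : V).
Hypotheses (normN : is_norm N) (cX : convex_set X).
Hypotheses (cf : forall i, convex_function setT (f i))
  (df : forall i x, differentiable (f i) x)
  (lipf : forall i, lipschitz_gradient N (Ls i) (f i)).
Hypotheses (scomega : strongly_convex N 1 X omega) (Xxs : X xs).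
Hypotheses (Ls0 : forall i, 0 <= Ls i) (p0 : forall i, 0 < p i) (p1 : \sum_i p i = 1).
Hypotheses (tau0 : 0 < tau) (eta0 : 0 < eta) (alpha01 : 0 < alpha < 1).
Hypotheses (contr_dual : forall i, (1 - alpha) * (1 + tau) <= p i)
  (contr_primal : eta <= alpha * (eta + mu))
  (coupling : forall i, 4 * Ls i <= eta * tau * p i).
Hypotheses (Xx0 : X x0) (subg0 : subdifferential X omega x0 g0) (mu0 : 0 < mu).
Hypothesis (chhat : convex_function X hhat).

Variables (k : nat) (i_ : {ffun 'I_k -> 'I_m} -> nat -> 'I_m)
  (z : {ffun 'I_k -> 'I_m} -> trajectory R n m).
Hypotheses (i_w : forall w (t : 'I_k), i_ w t.+1 = w t)
  (zP : forall w, rpdg_trajectory X f hhat omega mu p tau eta alpha x0 g0 k (i_ w) (z w))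
  (nonanticipative : forall (w w' : {ffun 'I_k -> 'I_m}) t, (t <= k)%N ->
     (forall r : 'I_k, (r < t)%N -> w r = w' r) -> rg (z w) t = rg (z w') t).

Local Notation G := (linear_gap f hhat omega mu xs).
Local Notation Phi := (rpdg_potential N f omega p mu tau eta xs).
Local Notation weight := (word_weight p).

Let gap t := \sum_w weight w * G (rx (z w) t).
Let pot t := \sum_w weight w * Phi (rx (z w) t) (rx (z w) t.-1) (rxu (z w) t) (rg (z w) t).

Let alpha_le : 0 <= alpha <= 1.
Proof. by case/andP: alpha01 => /ltW -> /ltW ->. Qed.

Lemma prefix_state (w w' : {ffun 'I_k -> 'I_m}) t : (t <= k)%N ->
  (forall r : 'I_k, (r < t)%N -> w r = w' r) ->
  rx (z w) t = rx (z w') t /\ rxu (z w) t =1 rxu (z w') t.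
Proof.
move=> tk ww'.
apply: (trajectory_unique normN cX scomega mu0 eta0 (zP w) (zP w')) => //.
  (* Draws are numbered from 1, letters of a word from 0. *)
  case=> // r /= rt; have rk := leq_trans rt tk.
  by rewrite (i_w w (Ordinal rk)) (i_w w' (Ordinal rk)) ww'.
move=> r rt; apply: nonanticipative; first exact: leq_trans tk.
by move=> s sr; apply: ww'; exact: leq_trans rt.
Qed.

(** Redrawing letter t does not change the state at time t, so [expected_one_step] applies for each
    choice of the other letters. *)
Lemma expected_descent t : (t < k)%N -> gap t.+1 + pot t.+1 <= alpha * pot t.
Proof.
move=> tk; pose s := Ordinal tk.
rewrite /gap /pot -big_split/=.
under eq_bigr do rewrite -mulrDr.
rewrite -(redraw_weight_sum (fun w => G (rx (z w) t.+1) + Phi (rx (z w) t.+1)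
  (rx (z w) t) (rxu (z w) t.+1) (rg (z w) t.+1)) s p1).
rewrite mulr_sumr; apply: ler_sum => w _; rewrite mulrCA.
rewrite ler_wpM2l ?word_weight_ge0//.
have pre j (r : 'I_k) : (r < t)%N -> redraw w s j r = w r.
  by move=> rt; rewrite ffunE; case: eqP => // rs; rewrite rs ltnn in rt.
have pre' j t' : (t' <= t)%N -> rx (z (redraw w s j)) t' = rx (z w) t'
    /\ rxu (z (redraw w s j)) t' =1 rxu (z w) t'.
  move=> t't; apply: prefix_state; first exact: leq_trans (ltnW tk).
  by move=> r rt; apply: pre; exact: leq_trans t't.
have ex j : rx (z (redraw w s j)) t = rx (z w) t by case: (pre' j t (leqnn t)).
have exp j : rx (z (redraw w s j)) t.-1 = rx (z w) t.-1.
  by case: (pre' j t.-1 (leq_pred t)).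
have eu j : rxu (z (redraw w s j)) t =1 rxu (z w) t by case: (pre' j t (leqnn t)).
have eg j : rg (z (redraw w s j)) t = rg (z w) t.
  by apply: nonanticipative; [exact: ltnW|exact: pre].
have ei j : i_ (redraw w s j) t.+1 = j by rewrite (i_w _ s) ffunE eqxx.
have /choice[hg hgP] : forall j, exists hg,
   subdifferential X hhat (rx (z (redraw w s j)) t.+1) hg /\
   forall u, X u -> 0 <= dot (\sum_i ryt (z (redraw w s j)) t.+1 i + hg
      + mu *: rg (z (redraw w s j)) t.+1
      + eta *: (rg (z (redraw w s j)) t.+1 - rg (z w) t)) (u - rx (z (redraw w s j)) t.+1).
  move=> j; have [hg h1 h2] := rpdg_optimality (zP (redraw w s j)) tk.
  by exists hg; split => //; rewrite -(eg j).
under eq_bigr do rewrite ex.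
apply: (@expected_one_step R n m N X f Ls hhat omega p mu tau eta alpha xs normN cX cf df lipf
  scomega Xxs Ls0 p0 p1 tau0 eta0 alpha_le contr_dual contr_primal coupling _ _ _ _
  (fun j => rx (z (redraw w s j)) t.+1) (fun j => rg (z (redraw w s j)) t.+1)
  (fun j => rxu (z (redraw w s j)) t.+1) hg).
- exact: (trajectory_mem Xx0 (zP w) (ltnW tk)).
- by move=> j; apply: (trajectory_mem Xx0 (zP _)).
- exact: (trajectory_subdifferential subg0 (zP w) (ltnW tk)).
- by move=> j i; rewrite (rpdg_xu (zP _) i tk) ei ex exp !eu; case: eqP => // ->.
- by move=> j; case: (hgP j).
- move=> j u Xu; case: (hgP j) => _ /(_ u Xu).
  rewrite (trajectory_dual_sum (zP _) tk) ei eu.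
  by under eq_bigr => i _ do rewrite eu.
Qed.

(** The descent inequality multiplied by alpha^(-t) telescopes; this explains the output weights. *)
Lemma expected_gap_sum k' : (k' <= k)%N ->
  \sum_(1 <= t < k'.+1) alpha ^- t * gap t + alpha ^- k' * pot k' <= pot 0.
Proof.
have alpha0 : 0 < alpha by case/andP: alpha01.
elim: k' => [_|k' IH k'k]; first by rewrite big_nil// add0r expr0 invr1 mul1r.
rewrite big_nat_recr//=; have := IH (ltnW k'k); apply: le_trans.
rewrite -addrA lerD2l -mulrDr.
have ai : 0 <= alpha ^- k'.+1 by rewrite invr_ge0 exprn_ge0 ?(ltW alpha0).
have h := ler_wpM2l ai (expected_descent k'k).
apply: le_trans h _.
by rewrite mulrA exprS invfM [X in X * _]mulrAC mulVf ?gt_eqF// mul1r.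
Qed.

Lemma pot_ge0 t : (t <= k)%N -> 0 <= pot t.
Proof.
move=> tk; apply: sumr_ge0 => w _; rewrite mulr_ge0 ?word_weight_ge0//.
apply: (rpdg_potential_ge0 normN cX cf df lipf scomega Xxs p0 p1 tau0 eta0 coupling).
- exact: ltW.
- exact: (trajectory_mem Xx0 (zP w)).
- exact: (trajectory_subdifferential subg0 (zP w)).
Qed.

Lemma pot_initial : pot 0 = (eta + mu) * prox omega g0 x0 xs
  + (1 + tau) * \sum_i (p i)^-1 * bregman (f i) x0 xs.
Proof.
set c := RHS; rewrite /pot -[c]mul1r -(word_weight_sum (k := k) p1) mulr_suml.
apply: eq_bigr => w _; congr (_ * _).
rewrite /rpdg_potential (rpdg_x0 (zP w)) (rpdg_g0 (zP w)) subrr dot0r (norm_zero normN).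
rewrite expr0n/= mulr0 !addr0.
by under eq_bigr do rewrite (rpdg_xu0 (zP w)).
Qed.

Lemma sum_inverse_powers : \sum_(1 <= t < k.+1) alpha ^- t = (alpha ^- k - 1) / (1 - alpha).
Proof.
have /andP[alpha0 alpha1] := alpha01.
elim: (k) => [|k' IH]; first by rewrite big_nil// expr0 invr1 subrr mul0r.
rewrite big_nat_recr//= IH exprS invfM.
have a0 : alpha != 0 by rewrite gt_eqF.
have a1 : 1 - alpha != 0 by rewrite gt_eqF// subr_gt0.
set a := alpha ^- k'; field.
by rewrite a0 a1.
Qed.

Lemma linear_gap_convex : convex_function X G.
Proof.
apply: convex_functionI => x y s Xx Xy s01.
have h1 := convex_functionP chhat Xx Xy s01.
have h2 := scomega Xx Xy s01; have /andP[s0 s1] := s01.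
have : 0 <= s * (1 - s) * N (x - y) ^+ 2 by rewrite mulr_ge0 ?sqr_ge0// mulr_ge0// subr_ge0.
move=> /(mulr_ge0 (ltW mu0)); have {h2} := ler_wpM2l (ltW mu0) h2.
rewrite /linear_gap !dotE; lra.
Qed.

(** Drop the nonnegative final potential, divide by the sum of the weights and apply Jensen's
    inequality on each word. *)
Lemma expected_linear_gap : (0 < k)%N ->
  \sum_w weight w * G (rpdg_output alpha k (z w)) <=
  (1 - alpha) / (alpha ^- k - 1) * ((eta + mu) * prox omega g0 x0 xs
    + (1 + tau) * \sum_i (p i)^-1 * bregman (f i) x0 xs).
Proof.
move=> k0; have /andP[alpha0 alpha1] := alpha01.
have theta0 t : 0 < alpha ^- t by rewrite invr_gt0 exprn_gt0.
have h := expected_gap_sum (leqnn k).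
have : \sum_(1 <= t < k.+1) alpha ^- t * gap t <= pot 0.
  by apply: le_trans h; rewrite lerDl mulr_ge0 ?pot_ge0// ltW.
rewrite pot_initial -[(1 - alpha) / _]invf_div -sum_inverse_powers => h2.
set S := \sum_(1 <= t < _) _.
have S0 : 0 < S^-1.
  rewrite invr_gt0 /S; case: (k) k0 => // k' _; rewrite big_nat_recr//= ltr_wpDl//.
  by apply: sumr_ge0 => t _; exact: ltW.
apply: le_trans (ler_wpM2l (ltW S0) h2).
have E : \sum_(1 <= t < k.+1) alpha ^- t * gap t =
    \sum_w weight w * \sum_(1 <= t < k.+1) alpha ^- t * G (rx (z w) t).
  under eq_bigr do rewrite /gap mulr_sumr.
  rewrite exchange_big; apply: eq_bigr => w _; rewrite mulr_sumr.
  by apply: eq_bigr => t _; rewrite mulrCA.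
rewrite E mulr_sumr; apply: ler_sum => w _; rewrite mulrCA.
rewrite ler_wpM2l ?word_weight_ge0//.
have [//|t /andP[t0 tk]|_] :=
  @weighted_average_convex _ _ X G _ (rx (z w)) cX linear_gap_convex theta0 k.
  exact: (trajectory_mem Xx0 (zP w)).
exact.
Qed.

End expected_descent.

(** * Law of the draws *)

Section law_of_draws.
Context {R : realType} {m k : nat} {d : measure_display} {T : measurableType d}.
Variables (P : probability T R) (p : 'I_m -> R) (i_ : nat -> T -> 'I_m).
Hypothesis iid : iid_draws P p k i_.

Definition draw_word (s : T) : {ffun 'I_k -> 'I_m} := [ffun t : 'I_k => i_ t.+1 s].

(** Independence is stated for families indexed by nat: this condition fixes draw t for t in 1..k
    and is void for any other t. *)
Let cylinder (w : {ffun 'I_k -> 'I_m}) t : set 'I_m :=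
  [set j | forall r : 'I_k, r.+1 = t -> j = w r].

Let cylinderS w (r : 'I_k) : cylinder w r.+1 = [set w r].
Proof.
apply/seteqP; split=> [j /(_ r erefl)//|j -> r' [rr']].
by congr (w _); exact/val_inj.
Qed.

Let draw_word_cylinder w : draw_word @^-1` [set w] =
  \bigcap_(t in [set` iota 1 k]) (i_ t @^-1` cylinder w t).
Proof.
apply/seteqP; split=> [s sw t _ r rt|s sw] /=.
  by rewrite -(sw : draw_word s = w) ffunE rt.
apply/ffunP => r; rewrite ffunE.
by apply: (sw r.+1) => //; rewrite /= mem_iota add1n /= ltnS ltn_ord.
Qed.

Lemma measurable_draw_word w : measurable (draw_word @^-1` [set w]).
Proof.
rewrite draw_word_cylinder; apply: bigcap_measurableType => t.
rewrite /= mem_iota add1n ltnS => /andP[t0 tk].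
case: t t0 tk => // t _ tk; rewrite (cylinderS w (Ordinal tk)).
exact: (draws_measurable iid).
Qed.

Lemma draw_word_law w : P (draw_word @^-1` [set w]) = (word_weight p w)%:E.
Proof.
rewrite draw_word_cylinder (draws_independent iid) ?iota_uniq//; last first.
  by move=> t; rewrite mem_iota add1n ltnS.
rewrite (_ : iota 1 k = index_iota 1 k.+1); last by rewrite /index_iota subSS subn0.
rewrite big_add1 big_mkord /word_weight -prodEFin; apply: eq_bigr => r _.
by rewrite cylinderS (draws_law iid) //=.
Qed.

(** The integrand is a finite nonnegative combination of indicators of word events, whose measures
    are the word weights. *)
Lemma expectation_draw_word (phi : {ffun 'I_k -> 'I_m} -> R) :
  (forall w, 0 <= phi w) ->
  ('E_P[fun s => phi (draw_word s)])%E = (\sum_w word_weight p w * phi w)%:E.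
Proof.
move=> phi0; rewrite unlock.
have E s : (phi (draw_word s))%:E =
    (\sum_w (phi w)%:E * (\1_(draw_word @^-1` [set w]) s)%:E)%E.
  rewrite (bigD1 (draw_word s))//= big1 ?adde0 => [|w sw].
    by rewrite indicE mem_set//= mule1.
  by rewrite indicE memNset ?mule0//= => ws; rewrite -ws eqxx in sw.
under eq_integral do rewrite E.
rewrite ge0_integral_sum//=; last 2 first.
- move=> w; apply: emeasurable_funM; first exact: measurable_cst.
  by apply/measurable_EFinP/measurable_indic/measurable_draw_word.
- by move=> w s _; rewrite mule_ge0// lee_fin.
rewrite -sumEFin; apply: eq_bigr => w _.
rewrite ge0_integralZl//=; last 2 first.
- by apply/measurable_EFinP/measurable_indic/measurable_draw_word.
- by rewrite lee_fin.
rewrite (integral_indic P measurableT (measurable_draw_word w)) setIT.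
by rewrite EFinM muleC; congr (_ * _)%E; exact: draw_word_law.
Qed.

Lemma probability_draw_word (Q : pred {ffun 'I_k -> 'I_m}) :
  P [set s | Q (draw_word s)] = (\sum_w word_weight p w * (Q w)%:R)%:E.
Proof.
have mQ : measurable [set s | Q (draw_word s)].
  rewrite (_ : [set s | _] = \bigcup_(w in [set` Q]) (draw_word @^-1` [set w])).
    by apply: fin_bigcup_measurable => // w _; exact: measurable_draw_word.
  apply/seteqP; split=> [s Qs|s [w Qw sw]]; first by exists (draw_word s).
  by rewrite /= (sw : draw_word s = w).
rewrite -(expectation_draw_word (phi := fun w => (Q w)%:R))//.
rewrite -(expectation_indic P mQ); congr expectation.
apply/funext => s; rewrite indicE.
by have -> : (s \in [set s | Q (draw_word s)]) = Q (draw_word s)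
  by apply/idP/idP; rewrite inE.
Qed.

End law_of_draws.

(** * Parameters *)

Section parameter_identities.
Context {R : realType} {m : nat} (Ls : 'I_m -> R) (mu : R).
Hypotheses (m0 : (0 < m)%N) (Ls0 : forall i, 0 <= Ls i) (mu0 : 0 < mu).

Local Notation L := (rpdg_L Ls).
Local Notation root := (rpdg_root Ls mu).
Local Notation p := (rpdg_p Ls).
Local Notation tau := (rpdg_tau Ls mu).
Local Notation eta := (rpdg_eta Ls mu).
Local Notation alpha := (rpdg_alpha Ls mu).

Lemma rpdg_L_ge0 : 0 <= L.
Proof. exact: sumr_ge0. Qed.

Let M1 : 1 <= m%:R :> R.
Proof. by rewrite ler1n. Qed.

Let M0 : 0 < m%:R :> R.
Proof. by rewrite ltr0n. Qed.

Let C0 : 0 <= 4 * m%:R * rpdg_C Ls mu.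
Proof.
have : 0 <= rpdg_C Ls mu by rewrite divr_ge0 ?(ltW mu0)// mulr_ge0// rpdg_L_ge0.
by apply: mulr_ge0; rewrite mulr_ge0.
Qed.

Lemma rpdg_root_sqr : root ^+ 2 = (m%:R - 1) ^+ 2 + 4 * m%:R * rpdg_C Ls mu.
Proof. by rewrite sqr_sqrtr// addr_ge0 ?sqr_ge0. Qed.

Lemma rpdg_root_ge : m%:R - 1 <= root.
Proof.
rewrite -[leLHS]ger0_norm ?subr_ge0// -sqrtr_sqr ler_wsqrtr// lerDl //.
Qed.

Let root0 : 0 <= root.
Proof. exact: sqrtr_ge0. Qed.

Lemma rpdg_alphaE : 1 - alpha = 1 / ((m%:R + 1) + root).
Proof. by rewrite /rpdg_alpha opprB addrCA subrr addr0. Qed.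

Lemma rpdg_alpha_itv : 0 < alpha < 1.
Proof.
have h : 1 < (m%:R + 1) + root by move: M1 root0; lra.
have h0 : 0 < (m%:R + 1) + root by move: M1 root0; lra.
rewrite /rpdg_alpha subr_gt0 ltrBlDl ltrDr divr_gt0// andbT.
by rewrite ltr_pdivrMr// mul1r.
Qed.

(** eta + mu = mu (m + 1 + root) / 2, and m + 1 + root is the inverse of 1 - alpha. *)
Lemma rpdg_eta_mu : (1 - alpha) * (eta + mu) = mu / 2.
Proof.
rewrite rpdg_alphaE /rpdg_eta; field.
by rewrite gt_eqF//; move: M1 root0; lra.
Qed.

(** Likewise 1 + tau = (m + 1 + root) / (2 m). *)
Lemma rpdg_tau_alpha : (1 - alpha) * (1 + tau) = 1 / (2 * m%:R).
Proof.
rewrite rpdg_alphaE /rpdg_tau; field.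
by rewrite !gt_eqF//; move: M1 root0; lra.
Qed.

Lemma rpdg_primal_contraction : eta <= alpha * (eta + mu).
Proof. have := rpdg_eta_mu; move: mu0; lra. Qed.

Lemma rpdg_dual_contraction i : (1 - alpha) * (1 + tau) <= p i.
Proof.
by rewrite rpdg_tau_alpha /rpdg_p lerDl divr_ge0// mulr_ge0// rpdg_L_ge0.
Qed.

Lemma rpdg_p_gt0 i : 0 < p i.
Proof.
by rewrite ltr_pwDl ?divr_gt0 ?mulr_gt0// divr_ge0// mulr_ge0// rpdg_L_ge0.
Qed.

Lemma rpdg_inv_p_le i : (p i)^-1 <= 2 * m%:R.
Proof.
rewrite -[leRHS]invrK lef_pV2 ?posrE ?rpdg_p_gt0 ?invr_gt0 ?mulr_gt0//.
by rewrite -[leLHS]mul1r /rpdg_p lerDl divr_ge0// mulr_ge0// rpdg_L_ge0.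
Qed.

Lemma rpdg_inverse_step (Omega eps : R) : 0 < Omega -> 0 < eps ->
  mu = eps / (2 * Omega ^+ 2) ->
  (1 - alpha)^-1 <= 8 * (m%:R + Num.sqrt (m%:R * L * Omega ^+ 2 / eps)).
Proof.
move=> O0 e0 muE; set q := Num.sqrt _.
have q0 : 0 <= q by exact: sqrtr_ge0.
have q2 : q ^+ 2 = m%:R * L * Omega ^+ 2 / eps.
  rewrite sqr_sqrtr// divr_ge0 ?(ltW e0)// mulr_ge0 ?sqr_ge0//.
  by rewrite mulr_ge0// rpdg_L_ge0.
(* The value of mu gives 4 m C = 64 q^2, hence the factor 8. *)
have : root <= (m%:R - 1) + 8 * q.
  rewrite -(@ler_pXn2r _ 2)// ?nnegrE//; last by move: M1; lra.
  have -> : root ^+ 2 = (m%:R - 1) ^+ 2 + 64 * q ^+ 2.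
    rewrite rpdg_root_sqr q2 /rpdg_C muE; field.
    by rewrite !gt_eqF.
  have : 0 <= (m%:R - 1) * q by rewrite mulr_ge0// subr_ge0.
  lra.
rewrite rpdg_alphaE div1r invrK; move: M1; lra.
Qed.

Hypothesis L0 : 0 < L.

(** Positivity of L matters: division by zero yields 0, so for L = 0 the sum would be 1 / 2. *)
Lemma rpdg_p_sum : \sum_i p i = 1.
Proof.
rewrite /rpdg_p big_split/= sumr_const card_ord -mulr_suml -/L -[_ *+ m]mulr_natl.
by field; rewrite !gt_eqF.
Qed.

Let C1 : 0 < 4 * m%:R * rpdg_C Ls mu.
Proof.
have : 0 < rpdg_C Ls mu by rewrite divr_gt0// mulr_gt0.
by apply: mulr_gt0; rewrite mulr_gt0.
Qed.

Let root1 : m%:R - 1 < root.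
Proof.
rewrite lt_neqAle rpdg_root_ge andbT; apply: contraPneq C1 => E.
by have := rpdg_root_sqr; rewrite -E; lra.
Qed.

Lemma rpdg_tau_gt0 : 0 < tau.
Proof. by rewrite divr_gt0 ?mulr_gt0// subr_gt0. Qed.

Lemma rpdg_eta_gt0 : 0 < eta.
Proof.
rewrite divr_gt0// -mulrDr mulr_gt0//; move: root1 M1; lra.
Qed.

Lemma rpdg_eta_tau : eta * tau = 8 * L.
Proof.
have -> : eta * tau = mu * (root ^+ 2 - (m%:R - 1) ^+ 2) / (4 * m%:R).
  by rewrite /rpdg_eta /rpdg_tau; field; rewrite gt_eqF.
rewrite rpdg_root_sqr /rpdg_C; field.
by rewrite !gt_eqF.
Qed.

Lemma rpdg_coupling i : 4 * Ls i <= eta * tau * p i.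
Proof.
rewrite rpdg_eta_tau /rpdg_p.
have -> : 8 * L * (1 / (2 * m%:R) + Ls i / (2 * L)) = 4 * Ls i + 4 * (L / m%:R).
  by field; rewrite !gt_eqF.
by rewrite lerDl mulr_ge0// divr_ge0// ltW.
Qed.

End parameter_identities.

(** * Number of iterations and final accuracy *)

Section iteration_count.
Context {R : realType}.

(** Take k just above 9 ln A / (1 - alpha) and use 1 / alpha >= exp(1 - alpha). The constant is 9 *
    8 = 72 plus [(ln 2)^-1], which absorbs rounding up since ln A >= ln 2. *)
Lemma iteration_count (alpha A rate : R) : 0 < alpha < 1 -> 2 <= A ->
  1 <= rate -> (1 - alpha)^-1 <= 8 * rate ->
  exists k : nat, [/\ (0 < k)%N,
    k%:R <= (72 + (ln 2)^-1) * rate * ln A & A ^+ 9 <= alpha ^- k].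
Proof.
move=> /andP[alpha0 alpha1] A2 rate1 step.
have A0 : 0 < A by lra.
have ln2 : 0 < ln 2 :> R by rewrite ln_gt0// ltr1n.
have lnA : ln 2 <= ln A by rewrite ler_ln// posrE.
have lnA0 : 0 < ln A by exact: lt_le_trans lnA.
have b0 : 0 < 1 - alpha by rewrite subr_gt0.
pose y := 9 * ln A / (1 - alpha).
have y0 : 0 <= y by rewrite divr_ge0 ?mulr_ge0// ltW.
exists (Num.truncn y).+1; have /andP[ky yk] := truncn_itv y0; split => //.
  have h1 : y <= 72 * rate * ln A.
    by have := ler_wpM2l (mulr_ge0 (ler0n _ 9) (ltW lnA0)) step; rewrite /y; lra.
  have h2 : 1 <= (ln 2)^-1 * rate * ln A.
    have : 1 <= (ln 2)^-1 * ln A by rewrite mulrC ler_pdivlMr// mul1r.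
    by move=> h; rewrite mulrAC; apply: le_trans h _; rewrite ler_peMr// mulr_ge0 ?invr_ge0// ltW.
  by rewrite -natr1; lra.
set k := (Num.truncn y).+1 in yk *.
rewrite -[A](@lnK _ A) ?posrE// -expRM_natl.
have -> : alpha ^- k = (alpha^-1) ^+ k by rewrite exprVn.
have h : expR (1 - alpha) <= alpha^-1.
  rewrite -[expR _]invrK lef_pV2 ?posrE ?invr_gt0 ?expR_gt0// -expRN opprB.
  by have := expR_ge1Dx (alpha - 1); rewrite addrCA subrr addr0.
apply: le_trans (_ : expR (1 - alpha) ^+ k <= _).
  rewrite -expRM_natl ler_expR; move: yk; rewrite /y ltr_pdivrMr// => /ltW; lra.
by rewrite lerXn2r// nnegrE ?expR_ge0// invr_ge0 ltW.
Qed.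

(* kappa is the condition number Lf / delta of the perturbation problem. *)
Lemma accuracy_absorbed (A lambda kappa : R) : 2 <= A -> 0 < lambda <= 1 ->
  0 <= kappa <= 2 * A ^+ 2 ->
  (1 + kappa) * (1 / 2 + kappa) <= lambda * ((A / lambda) ^+ 9 - 1).
Proof.
move=> A2 /andP[l0 l1] /andP[k0 kA].
have A4 : 4 <= A ^+ 2 by have : 2 * 2 <= A * A by [apply: ler_pM]; rewrite expr2; lra.
have h1 : (1 + kappa) * (1 / 2 + kappa) <= (1 + 2 * A ^+ 2) ^+ 2.
  by rewrite expr2; apply: ler_pM; lra.
(* The exponent 9 is generous: with B = A^2, A^9 >= 2 B^4 dominates the square. *)
have h2 : (1 + 2 * A ^+ 2) ^+ 2 <= A ^+ 9 - 1.
  set B := A ^+ 2 in A4 *.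
  have h : 2 * (B * B * B * B) <= A ^+ 9.
    have -> : A ^+ 9 = A * (B * B * B * B) by rewrite /B; ring.
    by rewrite ler_wpM2r// !mulr_ge0//; lra.
  have b2 : 16 <= B * B by have : 4 * 4 <= B * B by [apply: ler_pM]; lra.
  have b4 : 16 * (B * B) <= B * B * B * B.
    by rewrite -[leRHS]mulrA ler_wpM2r//; lra.
  rewrite expr2; nra.
(* One of the nine powers of 1 / lambda cancels the factor lambda; the other eight are at least
   1. *)
have h3 : A ^+ 9 - 1 <= lambda * ((A / lambda) ^+ 9 - 1).
  have A90 : 0 <= A ^+ 9 by rewrite exprn_ge0//; lra.
  have -> : lambda * ((A / lambda) ^+ 9 - 1) = A ^+ 9 * (lambda^-1) ^+ 8 - lambda.
    by field; rewrite gt_eqF.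
  have : 1 <= lambda^-1 ^+ 8 by rewrite exprn_ege1// invf_ge1.
  move=> /(ler_wpM2l A90); lra.
lra.
Qed.

End iteration_count.

(** * The perturbed problem *)

Section perturbed_problem.
Context {R : realType} {n m : nat}.
Local Notation V := 'rV[R]_n.
Variables (N : V -> R) (X : set V) (f : 'I_m -> V -> R) (Ls : 'I_m -> R) (Lf : R).
Variables (h omega : V -> R) (x0 g0 : V) (Omega eps Psi_star Psid_star : R).

Local Notation L := (rpdg_L Ls).
Let F x := \sum_(i < m) f i x.
Let Psi x := F x + h x.
Local Notation delta := (eps / (2 * Omega ^+ 2)).
Let Psid x := F x + h x + delta * prox omega g0 x0 x.
Let hhat x := h x - delta * dot g0 x.
Local Notation p := (rpdg_p Ls).
Local Notation tau := (rpdg_tau Ls delta).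
Local Notation eta := (rpdg_eta Ls delta).
Local Notation alpha := (rpdg_alpha Ls delta).

Hypotheses (m0 : (0 < m)%N) (normN : is_norm N) (cX : convex_set X)
  (cf : forall i, convex_function setT (f i))
  (df : forall i x, differentiable (f i) x)
  (Ls0 : forall i, 0 <= Ls i)
  (lipf : forall i, lipschitz_gradient N (Ls i) (f i))
  (Lf0 : 0 <= Lf)
  (lipF : lipschitz_gradient N Lf F)
  (ch : convex_function X h) (scomega : strongly_convex N 1 X omega)
  (Xx0 : X x0) (subg0 : subdifferential X omega x0 g0)
  (Omega0 : 0 < Omega)
  (diam : forall x, X x -> prox omega g0 x0 x <= Omega ^+ 2)
  (minPsi : is_min X Psi Psi_star) (eps0 : 0 < eps)
  (minPsid : is_min X Psid Psid_star) (L0 : 0 < L).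

Let delta0 : 0 < delta.
Proof. by rewrite divr_gt0// mulr_gt0// exprn_gt0. Qed.

Let convex_hhat : convex_function X hhat.
Proof.
apply: convex_functionI => x y s Xx Xy s01.
by have := convex_functionP ch Xx Xy s01; rewrite /hhat !dotE; lra.
Qed.

Let diffF x : differentiable F x.
Proof.
rewrite (_ : F = \sum_i f i); first exact: differentiable_sum.
by apply/funext => y; rewrite fct_sumE.
Qed.

(** Differences are compared because the two forms of the perturbed objective agree up to an
    additive constant. *)
Let PsidE x y : Psid x - Psid y =
  F x + (hhat x + delta * omega x) - (F y + (hhat y + delta * omega y)).
Proof. by rewrite /Psid /hhat /prox !dotE; ring. Qed.

Lemma perturbed_gap_le xs x : X xs -> Psid xs = Psid_star -> X x ->
  Psid x - Psid_star <= (1 + Lf / delta) * linear_gap f hhat omega delta xs x.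
Proof.
move=> Xxs Exs Xx.
have sc := strongly_convex_add (ltW delta0) convex_hhat scomega.
rewrite mulr1 in sc.
have amin : is_argmin X (fun y => F y + (hhat y + delta * omega y)) xs.
  split=> // y Xy; rewrite -subr_ge0 -PsidE Exs subr_ge0.
  by case: minPsid => _; apply.
set G := linear_gap _ _ _ _ _ _; set q := N (x - xs) ^+ 2.
have h1 : delta / 2 * q <= G := composite_min_growth normN diffF lipF cX sc amin Xx.
have /ler_normlP[_ h2] : `|bregman F x xs| <= Lf / 2 * q := bregman_smooth normN diffF lipF x xs.
have E : Psid x - Psid_star = bregman F x xs + G.
  rewrite -Exs PsidE /bregman /G /linear_gap -/F; ring.
have Ldelta : 0 <= Lf / delta by rewrite divr_ge0// ltW.
have := ler_wpM2l Ldelta h1.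
have -> : Lf / delta * (delta / 2 * q) = Lf / 2 * q by field; rewrite !gt_eqF.
rewrite E; lra.
Qed.

(** On X the perturbation is nonnegative and at most delta Omega^2 = eps / 2. *)
Lemma perturbation_error x : X x -> Psi x - Psi_star <= (Psid x - Psid_star) + eps / 2.
Proof.
move=> Xx; have [[y Xy Ey] _] := minPsi; have [_ /(_ y Xy)] := minPsid.
have := ler_wpM2l (ltW delta0) (diam Xy).
have -> : delta * Omega ^+ 2 = eps / 2 by field; rewrite gt_eqF.
have := mulr_ge0 (ltW delta0) (prox_ge0 ler01 normN cX scomega Xx0 Xx subg0).
by rewrite -Ey /Psid /Psi; lra.
Qed.

Variables (lambda : R) (k : nat).
Hypotheses (lambda01 : 0 < lambda <= 1) (k0 : (0 < k)%N).
Let A := m%:R * Lf * Omega / eps.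
Hypotheses (A2 : 2 <= A) (OmegaA : Omega <= A) (kA : (A / lambda) ^+ 9 <= alpha ^- k).

Lemma expected_perturbed_gap (i_ : {ffun 'I_k -> 'I_m} -> nat -> 'I_m)
  (z : {ffun 'I_k -> 'I_m} -> trajectory R n m) :
  (forall w (t : 'I_k), i_ w t.+1 = w t) ->
  (forall w, rpdg_trajectory X f hhat omega delta p tau eta alpha x0 g0 k (i_ w) (z w)) ->
  (forall (w w' : {ffun 'I_k -> 'I_m}) t, (t <= k)%N ->
     (forall r : 'I_k, (r < t)%N -> w r = w' r) -> rg (z w) t = rg (z w') t) ->
  \sum_w word_weight p w * (Psid (rpdg_output alpha k (z w)) - Psid_star) <= lambda * (eps / 2).
Proof.
move=> i_w zP nonant.
have [[xs Xxs Exs] _] := minPsid.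
have a01 := rpdg_alpha_itv Ls delta m0; have /andP[alpha0 alpha1] := a01.
have X_out w : X (rpdg_output alpha k (z w)).
  exact: (trajectory_output_mem cX Xx0 (zP w)).
have kappa0 : 0 <= Lf / delta by rewrite divr_ge0// ltW.
set G := linear_gap f hhat omega delta xs.
apply: le_trans (_ : _ <= \sum_w word_weight p w *
    ((1 + Lf / delta) * G (rpdg_output alpha k (z w)))) _.
  apply: ler_sum => w _; rewrite ler_wpM2l ?word_weight_ge0//.
    exact: rpdg_p_gt0.
  exact: perturbed_gap_le.
under eq_bigr do rewrite mulrCA.
rewrite -mulr_sumr.
have := expected_linear_gap normN cX cf df lipf scomega Xxs Ls0 (rpdg_p_gt0 m0 Ls0)
  (rpdg_p_sum m0 L0) (rpdg_tau_gt0 m0 Ls0 delta0 L0) (rpdg_eta_gt0 m0 Ls0 delta0 L0) a01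
  (rpdg_dual_contraction delta m0 Ls0) (rpdg_primal_contraction Ls m0 delta0)
  (rpdg_coupling m0 Ls0 delta0 L0) Xx0 subg0 delta0 convex_hhat i_w zP nonant k0.
rewrite -/G; set EG := \sum_w _ => hEG.
set P0 := prox omega g0 x0 xs in hEG; set B0 := \sum_i _ in hEG.
have P0O : P0 <= Omega ^+ 2 by exact: diam.
(* The bound 1 / p i <= 2 m is uniform in i, so the divergences add up to that of F and only Lf
   enters. *)
have B0O : B0 <= 2 * m%:R * (Lf * Omega ^+ 2).
  apply: le_trans (_ : _ <= \sum_i 2 * m%:R * bregman (f i) x0 xs) _.
    apply: ler_sum => i _; rewrite ler_wpM2r//; last exact: rpdg_inv_p_le.
    exact: (convex_smooth_bregman_ge0 normN (df i) (@lipf i)).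
  rewrite -mulr_sumr -bregman_sum//; apply: ler_wpM2l; first by rewrite mulr_ge0.
  have /ler_normlP[_] := bregman_smooth normN diffF lipF x0 xs.
  move/le_trans; apply; rewrite mulrAC -mulrA ler_wpM2l//.
  have := le_prox normN cX scomega Xx0 Xxs subg0.
  rewrite -(norm_opp normN) opprB -/P0; lra.
have /andP[l0 l1] := lambda01.
have A0 : 0 < A by apply: lt_le_trans A2.
have Al : 2 <= A / lambda by rewrite ler_pdivlMr//; apply: le_trans A2; rewrite ger_pMr.
have D1 : 0 < alpha ^- k - 1.
  rewrite subr_gt0; apply: lt_le_trans kA; rewrite exprn_egt1//.
  by apply: lt_le_trans Al; rewrite ltr1n.
(* The factor 2 m in the bound on [B0] cancels against (1 - alpha) (1 + tau) = 1 / (2 m). *)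
have EGle : EG <= (delta / 2 + Lf) * Omega ^+ 2 / (alpha ^- k - 1).
  apply: le_trans hEG _; rewrite mulrAC ler_wpM2r ?invr_ge0 ?(ltW D1)//.
  rewrite mulrDr !(mulrA (1 - _)) rpdg_eta_mu// rpdg_tau_alpha// (mulrDl _ Lf); apply: lerD.
    by rewrite ler_wpM2l// divr_ge0// ltW.
  by rewrite mulrAC ler_pdivrMr ?mulr_gt0 ?ltr0n// mul1r mulrC.
have mpos : 0 < m%:R :> R by rewrite ltr0n.
have kappaA : 0 <= Lf / delta <= 2 * A ^+ 2.
  rewrite kappa0/=.
  have -> : Lf / delta = 2 * (A / m%:R * Omega) by rewrite /A; field; rewrite !gt_eqF.
  have Am : A / m%:R <= A by rewrite ler_pdivrMr// ler_peMr ?ler1n// ltW.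
  rewrite ler_pM2l// expr2; apply: ler_pM => //; last exact: ltW.
  by rewrite divr_ge0 ?(ltW A0).
have := accuracy_absorbed A2 lambda01 kappaA.
set kappa := Lf / delta in kappa0 kappaA *.
move=> hk; have k10 : 0 <= 1 + kappa by rewrite addr_ge0.
apply: le_trans (ler_wpM2l k10 EGle) _.
have -> : (delta / 2 + Lf) * Omega ^+ 2 = eps / 2 * (1 / 2 + kappa).
  by rewrite /kappa; field; rewrite !gt_eqF.
have hk2 : (1 + kappa) * (1 / 2 + kappa) <= lambda * (alpha ^- k - 1).
  by apply: le_trans hk _; rewrite ler_pM2l// lerD2r.
move: D1 hk2; set D := alpha ^- k - 1 => D1 hk2.
rewrite [leLHS]mulrA ler_pdivrMr//; have := ler_wpM2l (ltW eps0) hk2; lra.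
Qed.

Section one_run.
Context {d : measure_display} {T : measurableType d}.
Variables (P : probability T R) (i_ : nat -> T -> 'I_m) (z : T -> trajectory R n m).
Hypothesis run : rpdg_run P X f hhat omega delta p tau eta alpha x0 g0 k i_ z.

Let iid : iid_draws P p k i_ := run_draws run.

Let p0 i : 0 < p i.
Proof. exact: rpdg_p_gt0. Qed.

Lemma run_output_mem s : X (rpdg_output alpha k (z s)).
Proof.
have /andP[alpha0 _] := rpdg_alpha_itv Ls delta m0.
exact: (trajectory_output_mem cX Xx0 (run_trajectory run s)).
Qed.

Lemma draw_word_surjective (w : {ffun 'I_k -> 'I_m}) : exists s, draw_word i_ s = w.
Proof.
have [E|/set0P[s sw]] := eqVneq (draw_word i_ @^-1` [set w]) set0; last by exists s.
have := draw_word_law iid w; rewrite E measure0 => /eqP; rewrite eqe lt_eqF//.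
by rewrite /word_weight prodr_gt0.
Qed.

(* The nonanticipative choice of the subgradients makes a run a function of the
   word of its draws; every word has positive probability, hence occurs. *)
Lemma run_factors : exists out : {ffun 'I_k -> 'I_m} -> V,
  [/\ forall w, X (out w),
      forall s, rpdg_output alpha k (z s) = out (draw_word i_ s) &
      \sum_w word_weight p w * (Psid (out w) - Psid_star) <= lambda * (eps / 2)].
Proof.
(* [sw w] is a sample whose draws spell w; its run represents all samples with that word. *)
have /choice[sw swP] := draw_word_surjective.
exists (fun w => rpdg_output alpha k (z (sw w))); split.
- by move=> w; exact: run_output_mem.
- move=> s; set w := draw_word i_ s; congr (_ *: _).
  apply: eq_big_nat => t /andP[_ tk]; congr (_ *: _).
  have draws_eq : forall r, (0 < r <= k)%N -> i_ r s = i_ r (sw w).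
    case=> // r rk; have : draw_word i_ s (Ordinal rk) = draw_word i_ (sw w) (Ordinal rk).
      by rewrite swP.
    by rewrite !ffunE.
  have agree t' r : (t' <= k)%N -> (0 < r <= t')%N -> i_ r s = i_ r (sw w).
    by move=> t'k /andP[r0 rt]; rewrite draws_eq// r0 (leq_trans rt).
  have [//|r|r rt|-> //] := trajectory_unique normN cX scomega delta0
    (rpdg_eta_gt0 m0 Ls0 delta0 L0) (run_trajectory run s) (run_trajectory run (sw w)) (t := t).
    exact: agree.
  have rk : (r <= k)%N := leq_trans rt tk.
    by apply: (run_nonanticipative run) => // r'; exact: agree.
apply: (expected_perturbed_gap (i_ := fun w t => i_ t (sw w))).
- by move=> w t; rewrite -[in RHS](swP w) ffunE.
- by move=> w; exact: (run_trajectory run).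
move=> w w' t tk ww'; apply: (run_nonanticipative run) => //.
case=> // r /= rt; have rk := leq_trans rt tk.
have := ww' (Ordinal rk) rt.
by rewrite -[in LHS](swP w) -[in RHS](swP w') !ffunE.
Qed.

Lemma run_expectation :
  ('E_P[fun s => (Psi (rpdg_output alpha k (z s)) - Psi_star)%R]
     <= (lambda * (eps / 2) + eps / 2)%:E)%E.
Proof.
have [out [Xout outE gapE]] := run_factors.
under [X in 'E_P[X]%E]eq_fun do rewrite outE.
rewrite (expectation_draw_word iid (phi := fun w => Psi (out w) - Psi_star)); last first.
  by move=> w; rewrite subr_ge0; case: minPsi => _; apply.
rewrite lee_fin.
apply: le_trans (_ : _ <= \sum_w (word_weight p w * (Psid (out w) - Psid_star)
    + word_weight p w * (eps / 2))) _.
  apply: ler_sum => w _; rewrite -mulrDr ler_wpM2l ?word_weight_ge0//.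
  exact: perturbation_error.
by rewrite big_split/= -mulr_suml word_weight_sum ?mul1r ?lerD2r// rpdg_p_sum.
Qed.

Lemma run_probability :
  (P [set s | (eps < Psi (rpdg_output alpha k (z s)) - Psi_star)%R] <= lambda%:E)%E.
Proof.
have [out [Xout outE gapE]] := run_factors.
pose Q w := eps < Psi (out w) - Psi_star.
rewrite (_ : [set s | _] = [set s | Q (draw_word i_ s)]); last first.
  by apply/seteqP; split=> s /=; rewrite /Q outE.
rewrite (probability_draw_word iid) lee_fin.
(* Markov's inequality: an original gap above eps forces a perturbed gap above eps / 2. *)
apply: le_trans (_ : _ <= (2 / eps) * \sum_w word_weight p w * (Psid (out w) - Psid_star)) _.
  rewrite mulr_sumr; apply: ler_sum => w _.
  rewrite mulrCA ler_wpM2l ?word_weight_ge0// mulrAC ler_pdivlMr//.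
  have gap0 : 0 <= Psid (out w) - Psid_star.
    by rewrite subr_ge0; case: minPsid => _; apply.
  have := perturbation_error (Xout w); rewrite /Q; by case: ltP => gt_eps /=; lra.
rewrite mulrAC ler_pdivrMr//; move: gapE; lra.
Qed.

End one_run.
End perturbed_problem.

(** * Complexity in expectation and with high probability *)

Theorem proposition1 (R : realType) :
  exists c : R, 0 < c /\
  forall (n m : nat) (N : 'rV[R]_n -> R) (X : set 'rV[R]_n)
    (f : 'I_m -> 'rV[R]_n -> R) (Ls : 'I_m -> R) (Lf : R)
    (h omega : 'rV[R]_n -> R) (x0 g0 : 'rV[R]_n)
    (Omega eps Psi_star Psid_star : R),
  let L := rpdg_L Ls in
  let F := fun x => \sum_(i < m) f i x in
  let Psi := fun x => F x + h x in
  let delta := eps / (2 * Omega ^+ 2) in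
  let Psid := fun x => F x + h x + delta * prox omega g0 x0 x in
  let hhat := fun x => h x - delta * dot g0 x in
  let p := rpdg_p Ls in
  let tau := rpdg_tau Ls delta in
  let eta := rpdg_eta Ls delta in
  let alpha := rpdg_alpha Ls delta in
  let rate := m%:R + Num.sqrt (m%:R * L * Omega ^+ 2 / eps) in
  (0 < m)%N ->
  is_norm N ->
  closed X -> convex_set X -> bounded_set X ->
  (forall i, convex_function setT (f i)) ->
  (forall i x, differentiable (f i) x) ->
  (forall i, 0 <= Ls i) ->
  (forall i x1 x2, dual_norm N (gradient (f i) x1 - gradient (f i) x2)
                   <= Ls i * N (x1 - x2)) ->
  0 <= Lf ->
  (forall x1 x2, dual_norm N (gradient F x1 - gradient F x2)
                 <= Lf * N (x1 - x2)) ->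
  (forall x1 x2 : 'rV[R]_n, Lf * N (x1 - x2) <= L * N (x1 - x2)) ->
  convex_function X h ->
  strongly_convex N 1 X omega ->
  X x0 -> subdifferential X omega x0 g0 ->
  0 <= Omega -> (forall x, X x -> prox omega g0 x0 x <= Omega ^+ 2) ->
  is_min X Psi Psi_star ->
  0 < eps ->
  (* the range of (small) accuracies in which the O-bound is meant *)
  eps <= m%:R * Lf * Num.min 1 (Omega / 2) ->
  is_min X Psid Psid_star ->
  (exists k : nat, [/\ (0 < k)%N,
      k%:R <= c * rate * ln (m%:R * Lf * Omega / eps) &
      forall (d : measure_display) (T : measurableType d)
        (P : probability T R) (i_ : nat -> T -> 'I_m)
        (z : T -> trajectory R n m),
      rpdg_run P X f hhat omega delta p tau eta alpha x0 g0 k i_ z ->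
      (forall s, X (rpdg_output alpha k (z s))) /\
      ('E_P[fun s => (Psi (rpdg_output alpha k (z s)) - Psi_star)%R]
         <= eps%:E)%E])
  /\
  (forall lambda : R, 0 < lambda < 1 ->
   exists k : nat, [/\ (0 < k)%N,
      k%:R <= c * rate * ln (m%:R * Lf * Omega / (lambda * eps)) &
      forall (d : measure_display) (T : measurableType d)
        (P : probability T R) (i_ : nat -> T -> 'I_m)
        (z : T -> trajectory R n m),
      rpdg_run P X f hhat omega delta p tau eta alpha x0 g0 k i_ z ->
      (forall s, X (rpdg_output alpha k (z s))) /\
      (P [set s | (eps < Psi (rpdg_output alpha k (z s)) - Psi_star)%R]
         <= lambda%:E)%E]).
Proof.
exists (72 + (ln 2)^-1); split.
  by rewrite addr_gt0// invr_gt0 ln_gt0// ltr1n.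
move=> n m N X f Ls Lf h omega x0 g0 Omega eps Psi_star Psid_star L F Psi delta Psid hhat.
move=> p tau eta alpha rate m0 normN clX cX bX cf df Ls0 lipf Lf0 lipF LfL ch scomega.
move=> Xx0 subg0 Omega0 diam minPsi eps0 epsle minPsid.
have M0 : 0 < m%:R :> R by rewrite ltr0n.
(* The upper bound on the accuracy is positive, which forces both factors to be positive. *)
have [Lf1 Omega1] : 0 < Lf /\ 0 < Omega.
  have prod0 : 0 < m%:R * Lf * Num.min 1 (Omega / 2) by exact: lt_le_trans epsle.
  have Lf1 : 0 < Lf.
    by rewrite lt_neqAle Lf0 andbT; apply: contraTneq prod0 => <-; rewrite mulr0 mul0r ltxx.
  by move: prod0; rewrite pmulr_rgt0 ?mulr_gt0// lt_min ltr01 ltr_pdivlMr// mul0r.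
pose A := m%:R * Lf * Omega / eps.
have mLf : 0 < m%:R * Lf by rewrite mulr_gt0.
(* The two members of the minimum give A >= 2 and Omega <= A respectively. *)
have A2 : 2 <= A.
  rewrite ler_pdivlMr//.
  have : eps <= m%:R * Lf * (Omega / 2).
    by apply: le_trans epsle _; rewrite ler_pM2l// ge_min lexx orbT.
  lra.
have OmegaA : Omega <= A.
  rewrite ler_pdivlMr// mulrC ler_pM2r//; apply: le_trans epsle _.
  by rewrite ger_pMr// ge_min lexx.
have delta0 : 0 < delta by rewrite divr_gt0// mulr_gt0// exprn_gt0.
have alpha01 : 0 < alpha < 1 by exact: rpdg_alpha_itv.
have step : (1 - alpha)^-1 <= 8 * rate by exact: rpdg_inverse_step.
have rate1 : 1 <= rate by rewrite -[1]addr0 lerD ?sqrtr_ge0// ler1n.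
(* One statement serves both claims: lambda = 1 yields the expectation bound, lambda < 1 the
   probability bound. *)
have convergence lambda : 0 < lambda <= 1 -> exists k : nat, [/\ (0 < k)%N,
    k%:R <= (72 + (ln 2)^-1) * rate * ln (m%:R * Lf * Omega / (lambda * eps)) &
    forall (d : measure_display) (T : measurableType d) (P : probability T R)
      (i_ : nat -> T -> 'I_m) (z : T -> trajectory R n m),
    rpdg_run P X f hhat omega delta p tau eta alpha x0 g0 k i_ z ->
    [/\ forall s, X (rpdg_output alpha k (z s)),
      ('E_P[fun s => (Psi (rpdg_output alpha k (z s)) - Psi_star)%R]
        <= (lambda * (eps / 2) + eps / 2)%:E)%E &
      (P [set s | (eps < Psi (rpdg_output alpha k (z s)) - Psi_star)%R] <= lambda%:E)%E]].
  move=> /andP[l0 l1].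
  have -> : m%:R * Lf * Omega / (lambda * eps) = A / lambda.
    by rewrite /A; field; rewrite !gt_eqF.
  have Al : 2 <= A / lambda.
    by rewrite ler_pdivlMr//; apply: le_trans A2; rewrite ger_pMr.
  have [k [k0 kle kA]] := iteration_count alpha01 Al rate1 step.
  exists k; split => // d T P i_ z run.
  have l01 : 0 < lambda <= 1 by rewrite l0.
  have [L0|L0] := eqVneq L 0.
    (* Then Lf > 0 forces the norm to vanish, so the space is a single point. *)
    have xy (x y : 'rV[R]_n) : x = y.
      apply/eqP; rewrite -subr_eq0; apply/eqP/(norm_definite normN)/le_anti.
      rewrite norm_nonneg// andbT -(pmulr_rle0 _ Lf1).
      by apply: le_trans (LfL x y) _; rewrite L0 mul0r.
    have [[y Xy Ey] _] := minPsi.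
    have gap0 s : Psi (rpdg_output alpha k (z s)) - Psi_star = 0.
      by rewrite (xy (rpdg_output alpha k (z s)) y) Ey subrr.
    split=> [s||]; first by rewrite (xy (rpdg_output alpha k (z s)) y).
      have -> : (fun s => Psi (rpdg_output alpha k (z s)) - Psi_star) = cst 0.
        exact/funext.
      by rewrite expectation_cst lee_fin addr_ge0 ?mulr_ge0 ?divr_ge0// ltW.
    rewrite (_ : [set s | _] = set0) ?measure0 ?lee_fin ?(ltW l0)//.
    by apply/seteqP; split=> s //=; rewrite gap0 ltNge (ltW eps0).
  have {}L0 : 0 < L by rewrite lt_neqAle eq_sym L0 rpdg_L_ge0.
  split.
  - exact: (run_output_mem m0 cX Xx0 k0 run).
  - exact: (run_expectation m0 normN cX cf df Ls0 lipf Lf0 lipF ch scomega Xx0 subg0 Omega1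
      diam minPsi eps0 minPsid L0 l01 k0 A2 OmegaA kA run).
  - exact: (run_probability m0 normN cX cf df Ls0 lipf Lf0 lipF ch scomega Xx0 subg0 Omega1
      diam minPsi eps0 minPsid L0 l01 k0 A2 OmegaA kA run).
split.
  have [|k [k0 kle kP]] := convergence 1; first by rewrite ltr01 lexx.
  exists k; split => //; first by rewrite mul1r in kle.
  move=> d T P i_ z /kP[Xz Ez _]; split => //; apply: le_trans Ez _.
  by rewrite lee_fin; lra.
move=> lambda /andP[l0 l1].
have [|k [k0 kle kP]] := convergence lambda; first by rewrite l0 ltW.
by exists k; split => // d T P i_ z /kP[Xz _ Pz].
Qed.
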